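(* Assume that (1) $(A,B)$ is controllable and the collected data $w^d=\mathrm{col}(u^d,x^d)$ is a trajectory of the network system such that either (i) $u^d$ is persistently exciting of order $n+\tau$, or (ii) $\mathrm{col}(u_i^d,x^d_{\mathcal{N}_i})$ is persistently exciting of order $n_i+\tau$ for each $i\in S$ and $x^d_{\mathcal{N}_i}$ is persistently exciting of order $n_i+\tau$ for each $i\in\mathcal{V}\setminus S$; and (2) the data-based optimization problem (P) of the context is feasible for all $(u^{\mathrm{ini}},x^{\mathrm{ini}})$ which is a valid $T_{\mathrm{ini}}$-sample long system trajectory. Let $u^*$ and $x^*$ denote the optimal input and state trajectories of the LQR problem (L) of the context, let $y=\mathrm{col}(z,\lambda)$, and let $$M=\begin{bmatrix}-2\mathcal{Q}^{\mathsf T}&-\mathcal{A}^{\mathsf T}\\ \mathcal{A}&0\end{bmatrix},$$ where $\mathcal{Q}$, $\mathcal{A}$ are defined in the context. Let $\delta>0$ and $\rho=\frac{\delta^2}{N\|M^\dagger\|^2}$. With the primal-dual flow $(\dot z_i,\dot\lambda_i)$ defined in the context, if $\|\mathrm{col}(\dot z_i,\dot\lambda_i)\|^2<\rho$ for all $i\in\mathcal{V}$, then $\|u-u^*\|<\delta$, where $u$ is the input component of $z$.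
   Context: Notation: $[a,b]=\{a,\dots,b\}$ for integers $a<b$. $\mathrm{col}$ denotes vertical stacking; signals on finite intervals are identified with the stacked vectors of their samples, and for signals on the same interval in the definition of trajectories and data $\mathrm{col}(v_1,v_2)(t)=\mathrm{col}(v_1(t),v_2(t))$. $\|x\|_Q=\sqrt{x^{\mathsf T}Qx}$ for $Q\succeq0$; $M^\dagger$ is the Moore-Penrose pseudoinverse and $\|M^\dagger\|$ its induced 2-norm. For a signal $w:[0,T_d-1]\to\mathbb{R}^k$, the Hankel matrix $\mathcal{H}_\tau(w)\in\mathbb{R}^{k\tau\times(T_d-\tau+1)}$ has $(a,b)$ block entry $w(a+b)$, $a\in[0,\tau-1]$, $b\in[0,T_d-\tau]$. The signal is persistently exciting of order $t$ if $\mathcal{H}_t(w)$ has row rank $kt$. Network system: $\mathcal{G}=(\mathcal{V},\mathcal{E})$ is an undirected graph, $\mathcal{V}=[1,N]$, with neighbor sets $\mathcal{N}_i=\{j:(i,j)\in\mathcal{E}\}$, and $S\subset\mathcal{V}$ is the set of actuated nodes. Node $i$ has state $x_i\in\mathbb{R}^{n_i}$ and, if $i\in S$, input $u_i\in\mathbb{R}^{m_i}$, with dynamics $x_i(t+1)=A_{ii}x_i(t)+\sum_{j\in\mathcal{N}_i}A_{ij}x_j(t)+B_iu_i(t)$ for $i\in S$ and the same without the term $B_iu_i(t)$ for $i\notin S$. With $x=\mathrm{col}(x_1,\dots,x_N)\in\mathbb{R}^n$ and $u\in\mathbb{R}^m$ the stack of $u_i$, $i\in S$, the compact form is $x(t+1)=Ax(t)+Bu(t)$.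 A signal $\mathrm{col}(u,x)$ is a trajectory if it satisfies these dynamics on its time interval. $x_{\mathcal{N}_i}$ denotes the stack of $x_j$, $j\in\mathcal{N}_i$. Data: $u^d:[0,T_d-1]\to\mathbb{R}^m$, $x^d:[0,T_d-1]\to\mathbb{R}^n$. Fix the time horizon $T$ and $T_{\mathrm{ini}}>0$, and let $\tau=T_{\mathrm{ini}}+T+1$. Define $H_i$ as the vertical stack of $\mathcal{H}_\tau(u_i^d)$, $\mathcal{H}_\tau(x^d_{\mathcal{N}_i})$, $\mathcal{H}_\tau(x_i^d)$ if $i\in S$, and of $\mathcal{H}_\tau(x^d_{\mathcal{N}_i})$, $\mathcal{H}_\tau(x_i^d)$ if $i\notin S$. Objectives: $J_i(x_i,u_i)=\sum_{t=0}^{T-1}\left(\|x_i(t)\|_{Q_i}^2+\|u_i(t)\|_{R_i}^2\right)$ for $i\in S$, and $J_i(x_i)=\sum_{t=0}^{T-1}\|x_i(t)\|_{Q_i}^2$ for $i\notin S$, where $Q_i\in\mathbb{R}^{n_i\times n_i}$ is positive semidefinite and $R_i\in\mathbb{R}^{m_i\times m_i}$ is positive definite; $Q,R$ are the block-diagonal matrices of the $Q_i$ and $R_i$. Problem (P), for given $u^{\mathrm{ini}}:[0,T_{\mathrm{ini}}-1]\to\mathbb{R}^m$, $x^{\mathrm{ini}}:[0,T_{\mathrm{ini}}-1]\to\mathbb{R}^n$ forming a trajectory: minimize over $g=(g_i)$, $u=(u_i)_{i\in S}$, $x=(x_i)_{i\in\mathcal{V}}$ the cost $\sum_{i\in S}J_i(x_i,u_i)+\sum_{i\in\mathcal{V}\setminus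 S}J_i(x_i)$ subject to $H_ig_i=\mathrm{col}(u_i^{\mathrm{ini}},u_i,x^{\mathrm{ini}}_{\mathcal{N}_i},x_{\mathcal{N}_i},x_i^{\mathrm{ini}},x_i)$ for $i\in S$; $H_ig_i=\mathrm{col}(x^{\mathrm{ini}}_{\mathcal{N}_i},x_{\mathcal{N}_i},x_i^{\mathrm{ini}},x_i)$ for $i\notin S$; and $x_i(T)=0$ for all $i\in\mathcal{V}$. (In $H_ig_i=\mathrm{col}(\cdot)$, each signal is stacked over time, the initial segment of $T_{\mathrm{ini}}$ samples preceding the future samples, indexed from $0$.) Problem (L): minimize $\sum_{t=0}^{T-1}\left(\|x(t)\|_Q^2+\|u(t)\|_R^2\right)$ over $u,x$ subject to $x(t+1)=Ax(t)+Bu(t)$ for $t\in[0,T-1]$, $x(0)=Ax^{\mathrm{ini}}(T_{\mathrm{ini}}-1)+Bu^{\mathrm{ini}}(T_{\mathrm{ini}}-1)$, $x(T)=0$. Input sequences $u$, $u^*$ are compared on $[0,T-1]$. Primal-dual flow: let $z_i=\mathrm{col}(g_i,u_i,x_i)\in\mathbb{R}^{d_i}$ for $i\in S$, $z_i=\mathrm{col}(g_i,x_i)\in\mathbb{R}^{d_i}$ for $i\notin S$, $z=\mathrm{col}(z_1,\dots,z_N)$. Problem (P) is written as: minimize $\sum_{i\in\mathcal{V}}\|z_i\|_{\mathcal{Q}_i}^2$ subject to $\mathcal{A}_iz_{\mathcal{N}_i}=b_i$, $i\in\mathcal{V}$, where $z_{\mathcal{N}_i}$ here denotes the stack of $z_i$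 and $z_j$, $j\in\mathcal{N}_i$; $\mathcal{Q}_i\succeq0$ is the matrix such that $\|z_i\|_{\mathcal{Q}_i}^2$ is node $i$'s objective; and $\mathcal{A}_iz_{\mathcal{N}_i}=b_i\in\mathbb{R}^{c_i}$ collects node $i$'s linear equality constraints in (P). Let $F_i$ be the matrix with $F_iz=z_{\mathcal{N}_i}$, $\mathcal{Q}=\mathrm{diag}(\mathcal{Q}_1,\dots,\mathcal{Q}_N)$ (block diagonal), $\mathcal{A}=[F_1^{\mathsf T}\mathcal{A}_1^{\mathsf T},\dots,F_N^{\mathsf T}\mathcal{A}_N^{\mathsf T}]^{\mathsf T}$, $b=\mathrm{col}(b_1,\dots,b_N)$, $\lambda=\mathrm{col}(\lambda_1,\dots,\lambda_N)$ with $\lambda_i\in\mathbb{R}^{c_i}$. The Lagrangian is $\mathcal{L}(z,\lambda)=\sum_{i\in\mathcal{V}}\left(\|z_i\|_{\mathcal{Q}_i}^2+\lambda_i^{\mathsf T}(\mathcal{A}_iz_{\mathcal{N}_i}-b_i)\right)$, and the primal-dual flow is $\dot z_i=-\nabla_{z_i}\mathcal{L}(z,\lambda)$, $\dot\lambda_i=\nabla_{\lambda_i}\mathcal{L}(z,\lambda)=\mathcal{A}_iz_{\mathcal{N}_i}-b_i$; equivalently $\dot z=-2\mathcal{Q}z-\mathcal{A}^{\mathsf T}\lambda$, $\dot\lambda=\mathcal{A}z-b$. *)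

(* Defs.v *)
From HB Require Import structures.
From mathcomp Require Import all_boot all_order all_algebra.
From mathcomp Require Import all_classical all_reals all_analysis.

Set Implicit Arguments.
Unset Strict Implicit.
Unset Printing Implicit Defensive.

Import Order.TTheory GRing.Theory Num.Theory.
Import numFieldNormedType.Exports.

Local Open Scope classical_set_scope.
Local Open Scope ring_scope.

Section LinearAlgebra.
Context {R : realType}.

Definition psd p (Q : 'M[R]_p) : Prop :=
  Q^T = Q /\ forall x : 'cV[R]_p, 0 <= (x^T *m Q *m x) 0 0.

Definition pd p (Q : 'M[R]_p) : Prop :=
  Q^T = Q /\ forall x : 'cV[R]_p, x != 0 -> 0 < (x^T *m Q *m x) 0 0.

Definition wnorm p (Q : 'M[R]_p) (x : 'cV[R]_p) : R :=
  Num.sqrt ((x^T *m Q *m x) 0 0).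

(* The Euclidean norm; the library norm on matrices is the max norm. *)
Definition norm2 p (x : 'cV[R]_p) : R := Num.sqrt (\sum_i x i 0 ^+ 2).

Definition opnorm2 p q (M : 'M[R]_(p, q)) : R :=
  sup [set norm2 (M *m x) | x in [set x : 'cV[R]_q | norm2 x <= 1]].

Definition penrose p q (M : 'M[R]_(p, q)) (X : 'M[R]_(q, p)) : Prop :=
  [/\ M *m X *m M = M, X *m M *m X = X,
      (M *m X)^T = M *m X & (X *m M)^T = X *m M].

(* The Moore-Penrose pseudoinverse (the library's pinvmx is another partial
   inverse).  By mp_pinvP and penrose_uniq below, the default 0 is never used
   and the choice is irrelevant. *)
Definition mp_pinv p q (M : 'M[R]_(p, q)) : 'M[R]_(q, p) :=
  xget 0 [set X | penrose M X].

Lemma gram_eq0 p (v : 'rV[R]_p) : v *m v^T = 0 -> v = 0.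
Proof.
move=> /matrixP/(_ 0 0); rewrite !mxE => h.
have h0 : forall i, v 0 i ^+ 2 = 0.
  move=> i; apply/eqP; move/eqP: h.
  under eq_bigr do rewrite mxE -expr2.
  by rewrite psumr_eq0 => [/allP/(_ i (mem_index_enum i))//|j _]; exact: sqr_ge0.
by apply/rowP => i; rewrite mxE; apply/eqP; rewrite -sqrf_eq0 h0.
Qed.

Lemma gram_unit p q (F : 'M[R]_(p, q)) : row_free F -> F *m F^T \in unitmx.
Proof.
move=> Ff; rewrite -row_free_unit -kermx_eq0; apply/eqP/row_matrixP => i.
rewrite row0; set v := row i _.
have : v *m (F *m F^T) = 0 by apply/sub_kermxP; exact: row_sub.
move=> /(congr1 (fun w => w *m v^T)); rewrite mul0mx => h.
have : v *m F = 0.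
  by apply: gram_eq0; rewrite trmx_mul !mulmxA in h *.
by move=> /eqP; rewrite mulmx_free_eq0 // => /eqP.
Qed.

Lemma penrose_ex p q (M : 'M[R]_(p, q)) : exists X, penrose M X.
Proof.
have := mulmx_base M; have := col_base_full M; have := row_base_free M.
move: (col_base M) (row_base M) => C F freeF fullC <-.
pose GF := F *m F^T; pose GC := C^T *m C.
have uF : GF \in unitmx by exact: gram_unit.
have uC : GC \in unitmx.
  rewrite /GC -{2}[C]trmxK; apply: gram_unit.
  by rewrite /row_free mxrank_tr; exact: fullC.
have tF : (invmx GF)^T = invmx GF by rewrite trmx_inv /GF trmx_mul trmxK.
have tC : (invmx GC)^T = invmx GC by rewrite trmx_inv /GC trmx_mul trmxK.
exists (F^T *m invmx GF *m invmx GC *m C^T).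
have MX : C *m F *m (F^T *m invmx GF *m invmx GC *m C^T) = C *m invmx GC *m C^T.
  rewrite !mulmxA -[C *m F *m F^T]mulmxA -/GF -[C *m GF *m _]mulmxA.
  by rewrite mulmxV // mulmx1.
have XM : (F^T *m invmx GF *m invmx GC *m C^T) *m (C *m F) = F^T *m invmx GF *m F.
  rewrite !mulmxA -[_ *m C^T *m C]mulmxA -/GC.
  by rewrite -[_ *m invmx GC *m GC]mulmxA mulVmx // mulmx1.
split.
- rewrite MX !mulmxA -[_ *m C^T *m C]mulmxA -/GC.
  by rewrite -[_ *m invmx GC *m GC]mulmxA mulVmx // mulmx1.
- rewrite XM !mulmxA -[_ *m F *m F^T]mulmxA -/GF.
  by rewrite -[_ *m GF *m invmx GF]mulmxA mulmxV // mulmx1.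
- by rewrite MX !trmx_mul trmxK tC mulmxA.
- by rewrite XM !trmx_mul trmxK tF mulmxA.
Qed.

Lemma penrose_uniq p q (M : 'M[R]_(p, q)) X Y :
  penrose M X -> penrose M Y -> X = Y.
Proof.
move=> [x1 x2 x3 x4] [y1 y2 y3 y4].
have XM : X *m M = Y *m M.
  rewrite -[LHS](_ : X *m M *m (Y *m M) = _); last by rewrite -!mulmxA (mulmxA M) y1.
  by rewrite -x4 -y4 -trmx_mul -!mulmxA (mulmxA M) x1.
have MX : M *m X = M *m Y.
  rewrite -[LHS](_ : M *m Y *m (M *m X) = _); last by rewrite !mulmxA y1.
  by rewrite -x3 -y3 -trmx_mul !mulmxA x1.
by rewrite -x2 XM -mulmxA MX mulmxA y2.
Qed.

Lemma mp_pinvP p q (M : 'M[R]_(p, q)) : penrose M (mp_pinv M).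
Proof.
by have [X MX] := penrose_ex M; rewrite /mp_pinv; case: xgetP => [? -> //|/(_ X)].
Qed.

(* The matrix of a linear map on column vectors. *)
Definition mx_of p q (f : 'cV[R]_p -> 'cV[R]_q) : 'M[R]_(q, p) :=
  \matrix_(i, j) f (delta_mx j 0) i 0.

Definition grad p (f : 'cV[R]_p -> R) (v : 'cV[R]_p) : 'cV[R]_p :=
  \col_k 'D_(delta_mx k 0) f v.

(* [keep b v] is v if b holds and the empty vector otherwise; [unkeep] goes
   back, filling with 0. *)
Definition keep b p (v : 'cV[R]_p) : 'cV[R]_(if b then p else 0%N) :=
  if b return 'cV[R]_(if b then p else 0%N) then v else 0.

Definition unkeep b p : 'cV[R]_(if b then p else 0%N) -> 'cV[R]_p :=
  if b return 'cV[R]_(if b then p else 0%N) -> 'cV[R]_p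
  then id else fun=> 0.

End LinearAlgebra.

(* A signal on [0, L - 1] is represented by a function on nat of which only the
   values at t < L are ever used. *)
Section Signals.
Context {R : realType}.

Definition tstack L k (w : nat -> 'cV[R]_k) : 'cV[R]_(\sum_(t < L) k) :=
  \mxcol_(t < L) w t.

(* Junk for L <= t *)
Definition sample L k (v : 'cV[R]_(\sum_(t < L.+1) k)) (t : nat) : 'cV[R]_k :=
  submxcol v (inord t).

Definition concat k (L : nat) (w1 w2 : nat -> 'cV[R]_k) (t : nat) : 'cV[R]_k :=
  if (t < L)%N then w1 t else w2 (t - L)%N.

(* [Td.+1 - tau] is 0 when the data are shorter than tau. *)
Definition hankel Td tau k (w : nat -> 'cV[R]_k) :
    'M[R]_(\sum_(a < tau) k, Td.+1 - tau) :=
  \mxcol_(a < tau) \matrix_(r < k, b < Td.+1 - tau) w (a + b)%N r 0.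

Definition persistently_exciting Td k (w : nat -> 'cV[R]_k) (t : nat) : Prop :=
  \rank (hankel Td t w) = (k * t)%N.

Definition signal_norm L k (w : nat -> 'cV[R]_k) : R :=
  Num.sqrt (\sum_(t < L) norm2 (w t) ^+ 2).

End Signals.

(* A node outside [act] (the set S) has no input: this is encoded by an input
   of dimension 0, so that its input blocks are empty everywhere below. *)
Record network (R : realType) := Network {
  nnode : nat;
  edge : rel 'I_nnode;
  edge_sym : symmetric edge;
  edge_irrefl : irreflexive edge;
  act : {set 'I_nnode};
  xdim : 'I_nnode -> nat;
  udim : 'I_nnode -> nat;
  udim_nact : forall i, i \notin act -> udim i = 0%N;
  Ablk : forall i j, 'M[R]_(xdim i, xdim j);
  Bblk : forall i, 'M[R]_(xdim i, udim i)
}.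

Section Network.
Context {R : realType} (G : network R).
Local Notation N := (nnode G).

Definition nx : nat := (\sum_(i < N) xdim i)%N.
Definition nu : nat := (\sum_(i < N) udim i)%N.

Definition xi (i : 'I_N) (x : nat -> 'cV[R]_nx) (t : nat) : 'cV[R]_(xdim i) :=
  submxcol (x t) i.

Definition ui (i : 'I_N) (u : nat -> 'cV[R]_nu) (t : nat) : 'cV[R]_(udim i) :=
  submxcol (u t) i.

Definition ndim (i : 'I_N) : nat :=
  (\sum_(j < N) if edge i j then xdim j else 0)%N.

Definition xN (i : 'I_N) (x : nat -> 'cV[R]_nx) (t : nat) : 'cV[R]_(ndim i) :=
  \mxcol_j keep (edge i j) (xi j x t).

Definition Amx : 'M[R]_nx :=
  \mxblock_(i < N, j < N) (if (i == j) || edge i j then Ablk i j else 0).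

(* Block diagonal with rectangular blocks; conform_mx is used as in the
   library's mxdiag. *)
Definition Bmx : 'M[R]_(nx, nu) :=
  \mxblock_(i < N, j < N) (if i == j then conform_mx 0 (Bblk i) else 0).

Definition trajectory L (u : nat -> 'cV[R]_nu) (x : nat -> 'cV[R]_nx) : Prop :=
  forall t, (t.+1 < L)%N -> forall i : 'I_N,
    xi i x t.+1 = Ablk i i *m xi i x t
      + \sum_(j < N | edge i j) Ablk i j *m xi j x t + Bblk i *m ui i u t.

(* Every state can be steered to every other one in finite time. *)
Definition controllable : Prop :=
  forall x0 x1 : 'cV[R]_nx, exists L (u : nat -> 'cV[R]_nu)
    (x : nat -> 'cV[R]_nx),
    [/\ x 0%N = x0, x L = x1 &
        forall t, (t < L)%N -> x t.+1 = Amx *m x t + Bmx *m u t].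

Section Weights.
Variables (Q : forall i : 'I_N, 'M[R]_(xdim i)).
Variables (W : forall i : 'I_N, 'M[R]_(udim i)).

Definition lqr_cost T (u : nat -> 'cV[R]_nu) (x : nat -> 'cV[R]_nx) : R :=
  \sum_(t < T) (wnorm (\mxdiag_i Q i) (x t) ^+ 2
              + wnorm (\mxdiag_i W i) (u t) ^+ 2).

Definition lqr_feasible T Tini (uini : nat -> 'cV[R]_nu)
    (xini : nat -> 'cV[R]_nx) (u : nat -> 'cV[R]_nu)
    (x : nat -> 'cV[R]_nx) : Prop :=
  [/\ forall t, (t < T)%N -> x t.+1 = Amx *m x t + Bmx *m u t,
      x 0%N = Amx *m xini Tini.-1 + Bmx *m uini Tini.-1 & x T = 0].

Definition lqr_optimal T Tini uini xini u x : Prop :=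
  lqr_feasible T Tini uini xini u x /\
  forall u' x', lqr_feasible T Tini uini xini u' x' ->
    lqr_cost T u x <= lqr_cost T u' x'.

Definition node_cost T (i : 'I_N) (u : nat -> 'cV[R]_nu)
    (x : nat -> 'cV[R]_nx) : R :=
  \sum_(t < T) (wnorm (Q i) (xi i x t) ^+ 2 + wnorm (W i) (ui i u t) ^+ 2).

End Weights.

Section DataProblem.
Variables (Td T Tini : nat) (ud : nat -> 'cV[R]_nu) (xd : nat -> 'cV[R]_nx).

Definition tau : nat := (Tini + T + 1)%N.
Definition gdim : nat := (Td.+1 - tau)%N.

Definition hdim (i : 'I_N) : nat :=
  (\sum_(a < tau) udim i + (\sum_(a < tau) ndim i + \sum_(a < tau) xdim i))%N.

Definition Hmx (i : 'I_N) : 'M[R]_(hdim i, gdim) :=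
  col_mx (hankel Td tau (ui i ud))
    (col_mx (hankel Td tau (xN i xd)) (hankel Td tau (xi i xd))).

Definition hstack (i : 'I_N) (u : nat -> 'cV[R]_nu) (x : nat -> 'cV[R]_nx) :
    'cV[R]_(hdim i) :=
  col_mx (tstack tau (ui i u))
    (col_mx (tstack tau (xN i x)) (tstack tau (xi i x))).

(* The variables u and x of (P) are signals on [0, T], so that each constraint
   involves tau = Tini + (T + 1) samples. *)
Definition P_feasible (uini : nat -> 'cV[R]_nu) (xini : nat -> 'cV[R]_nx)
    (g : 'I_N -> 'cV[R]_gdim) (u : nat -> 'cV[R]_nu)
    (x : nat -> 'cV[R]_nx) : Prop :=
  forall i : 'I_N,
    Hmx i *m g i = hstack i (concat Tini uini u) (concat Tini xini x) /\
    xi i x T = 0.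

Definition zdim (i : 'I_N) : nat :=
  (gdim + (\sum_(t < T.+1) udim i + \sum_(t < T.+1) xdim i))%N.

(* The components of z_i = col(g_i, u_i, x_i). *)
Definition z_g i (z : 'cV[R]_(zdim i)) : 'cV[R]_gdim := usubmx z.
Definition z_u i (z : 'cV[R]_(zdim i)) : nat -> 'cV[R]_(udim i) :=
  sample (usubmx (dsubmx z)).
Definition z_x i (z : 'cV[R]_(zdim i)) : nat -> 'cV[R]_(xdim i) :=
  sample (dsubmx (dsubmx z)).

Definition u_of (z : forall i : 'I_N, 'cV[R]_(zdim i)) (t : nat) : 'cV[R]_nu :=
  \mxcol_i z_u (z i) t.
Definition x_of (z : forall i : 'I_N, 'cV[R]_(zdim i)) (t : nat) : 'cV[R]_nx :=
  \mxcol_i z_x (z i) t.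

Definition zNdim (i : 'I_N) : nat :=
  (\sum_(j < N) if (i == j) || edge i j then zdim j else 0)%N.

Definition ztot : nat := (\sum_(i < N) zdim i)%N.

Definition zN (i : 'I_N) (z : 'cV[R]_ztot) : 'cV[R]_(zNdim i) :=
  \mxcol_j keep ((i == j) || edge i j) (submxcol z j).

Definition zN_nth (i : 'I_N) (v : 'cV[R]_(zNdim i)) (j : 'I_N) :
    'cV[R]_(zdim j) :=
  unkeep (submxcol v j).

Definition Fmx (i : 'I_N) : 'M[R]_(zNdim i, ztot) := mx_of (zN i).

Definition cdim (i : 'I_N) : nat := (hdim i + xdim i)%N.

(* The constraints of node i with the terms in the unknowns on the left:
   H_i g_i - (stack with zero initial segment) = (stack of initial segment),
   and x_i(T) = 0. *)
Definition node_lhs (i : 'I_N) (v : 'cV[R]_(zNdim i)) : 'cV[R]_(cdim i) :=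
  col_mx
    (Hmx i *m z_g (zN_nth v i)
     - hstack i (concat Tini (fun=> 0) (u_of (zN_nth v)))
                (concat Tini (fun=> 0) (x_of (zN_nth v))))
    (z_x (zN_nth v i) T).

Definition node_A (i : 'I_N) : 'M[R]_(cdim i, zNdim i) := mx_of (@node_lhs i).

Definition node_b (uini : nat -> 'cV[R]_nu) (xini : nat -> 'cV[R]_nx)
    (i : 'I_N) : 'cV[R]_(cdim i) :=
  col_mx (hstack i (concat Tini uini (fun=> 0)) (concat Tini xini (fun=> 0))) 0.

Definition ctot : nat := (\sum_(i < N) cdim i)%N.

Definition Acal : 'M[R]_(ctot, ztot) := \mxcol_i (node_A i *m Fmx i).

Section Flow.
Variables (Q : forall i : 'I_N, 'M[R]_(xdim i)).
Variables (W : forall i : 'I_N, 'M[R]_(udim i)).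

(* There is no stage cost on g_i, u_i(T) and x_i(T). *)
Definition node_Q (i : 'I_N) : 'M[R]_(zdim i) :=
  block_mx 0 0 0
    (block_mx (\mxdiag_(t < T.+1) (if (t < T)%N then W i else 0)) 0
              0 (\mxdiag_(t < T.+1) (if (t < T)%N then Q i else 0))).

Definition Qcal : 'M[R]_ztot := \mxdiag_i node_Q i.

Definition lagrangian (uini : nat -> 'cV[R]_nu) (xini : nat -> 'cV[R]_nx)
    (z : 'cV[R]_ztot) (lam : 'cV[R]_ctot) : R :=
  \sum_(i < N) (wnorm (node_Q i) (submxcol z i) ^+ 2
    + ((submxcol lam i)^T *m (node_A i *m zN i z - node_b uini xini i)) 0 0).

Definition zdot uini xini (z : 'cV[R]_ztot) (lam : 'cV[R]_ctot) (i : 'I_N) :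
    'cV[R]_(zdim i) :=
  - submxcol (grad (fun z' => lagrangian uini xini z' lam) z) i.

Definition lamdot uini xini (z : 'cV[R]_ztot) (lam : 'cV[R]_ctot) (i : 'I_N) :
    'cV[R]_(cdim i) :=
  submxcol (grad (fun lam' => lagrangian uini xini z lam') lam) i.

Definition KKTmx : 'M[R]_(ztot + ctot) :=
  block_mx (- (2%:R *: Qcal^T)) (- Acal^T) Acal 0.

End Flow.
End DataProblem.
End Network.

(* The dynamics in compact form, and the reformulation of (P) in terms of z:
   the matrix equality constraint is feasibility in (P) (AcalE) and the weighted
   norm of z_i is the objective of node i (node_QE). *)
Lemma trajectory_compact (R : realType) (G : network R) L u x :
  trajectory L u x <-> forall t, (t.+1 < L)%N -> x t.+1 = Amx G *m x t + Bmx G *m u t.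
Proof.
suff H t : (forall i, xi i x t.+1 = Ablk i i *m xi i x t
      + \sum_(j < nnode G | edge i j) Ablk i j *m xi j x t + Bblk i *m ui i u t)
   <-> x t.+1 = Amx G *m x t + Bmx G *m u t.
  by split=> h t tL; [apply/H; exact: h | apply/H; exact: h].
have -> : Amx G *m x t + Bmx G *m u t = \mxcol_i (Ablk i i *m xi i x t
      + \sum_(j < nnode G | edge i j) Ablk i j *m xi j x t + Bblk i *m ui i u t).
  rewrite -{1}[x t]submxcolK -{1}[u t]submxcolK /Amx /Bmx !mul_mxblock_mxrow.
  rewrite -mxcolD; apply/eq_mxcol => i.
  congr (_ + _).
    rewrite (bigD1 i) //= eqxx /=; congr (_ + _).
    rewrite [RHS]big_mkcond [LHS]big_mkcond; apply: eq_bigr => j _.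
    rewrite eq_sym; case: eqVneq => [->|_]; first by rewrite edge_irrefl.
    by rewrite /=; case: (edge i j) => //; rewrite mul0mx.
  rewrite (bigD1 i) //= eqxx conform_mx_id big1 ?addr0 // => j.
  by rewrite eq_sym => /negbTE ->; rewrite mul0mx.
split=> [h|h i]; last by rewrite {1}/xi h mxcolK.
by rewrite -[x t.+1]submxcolK; apply/eq_mxcol => i; exact: h.
Qed.

Section Correctness.
Context {R : realType} (G : network R).
Variables (Td T Tini : nat) (ud : nat -> 'cV[R]_(nu G)) (xd : nat -> 'cV[R]_(nx G)).
Local Notation N := (nnode G).

Lemma mx_ofE p q (f : 'cV[R]_p -> 'cV[R]_q) v :
  (forall a u v, f (a *: u + v) = a *: f u + f v) -> mx_of f *m v = f v.
Proof.
move=> fL.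
have f0 : f 0 = 0 by have := fL (-1) 0 0; rewrite !scaleN1r oppr0 addr0 addNr.
have fs (I : finType) (c : I -> R) (w : I -> 'cV[R]_p) : f (\sum_i c i *: w i) = \sum_i c i *: f (w i).
  rewrite (@big_morph _ _ f 0 +%R 0 +%R) //; last by move=> a b; rewrite -{1}[a]scale1r fL scale1r.
  by apply: eq_bigr => i _; have := fL (c i) (w i) 0; rewrite f0 !addr0.
have -> : f v = f (\sum_i v i 0 *: delta_mx i 0).
  by congr f; rewrite [LHS]matrix_sum_delta; apply: eq_bigr => i _; rewrite big_ord1.
rewrite fs; apply/colP => i; rewrite !mxE summxE; apply: eq_bigr => j _.
by rewrite !mxE mulrC.
Qed.

Lemma keep_lin b p a (u v : 'cV[R]_p) : keep b (a *: u + v) = a *: keep b u + keep b v.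
Proof. by case: b => //=; apply/colP => -[]. Qed.
Lemma unkeep_lin b p a (u v : 'cV[R]_(if b then p else 0%N)) :
  unkeep (a *: u + v) = a *: unkeep u + unkeep v.
Proof. by case: b u v => //= u v; rewrite scaler0 addr0. Qed.
Lemma submxcol_lin n (d : 'I_n -> nat) a (u v : 'cV[R]_(\sum_i d i)) i :
  submxcol (a *: u + v) i = a *: submxcol u i + submxcol v i.
Proof. by apply/colP => k; rewrite !mxE. Qed.
Lemma mxcol_lin n (d : 'I_n -> nat) a (u v : forall i, 'cV[R]_(d i)) :
  \mxcol_i (a *: u i + v i) = a *: \mxcol_i u i + \mxcol_i v i.
Proof. by apply/colP => k; rewrite !mxE. Qed.

Lemma FmxE (i : 'I_N) z : Fmx Td T Tini i *m z = zN i z.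
Proof.
apply: mx_ofE => a u v; rewrite /zN -mxcol_lin; apply/eq_mxcol => j.
by rewrite submxcol_lin keep_lin.
Qed.

Lemma zN_nth_lin a (i : 'I_N) (u v : 'cV[R]_(zNdim Td T Tini i)) (j : 'I_N) :
  zN_nth (a *: u + v) j = a *: zN_nth u j + zN_nth v j.
Proof. by rewrite /zN_nth submxcol_lin unkeep_lin. Qed.

Lemma node_AE i v : node_A Td T Tini ud xd i *m v = node_lhs ud xd v.
Proof.
apply: mx_ofE => a u {}v; rewrite /node_lhs.
rewrite scale_col_mx add_col_mx; congr col_mx; last first.
  by rewrite zN_nth_lin; apply/colP => k; rewrite !mxE.
have -> : z_g (zN_nth (a *: u + v) i) = a *: z_g (zN_nth u i) + z_g (zN_nth v i).
  by rewrite zN_nth_lin; apply/colP => k; rewrite !mxE.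
rewrite mulmxDr -scalemxAr scalerBr addrACA -opprD; congr (_ - _).
rewrite /hstack !scale_col_mx !add_col_mx; congr (col_mx _ (col_mx _ _)).
- rewrite -mxcol_lin; apply/eq_mxcol => t; rewrite /ui /concat; case: ifP => _.
    by rewrite !submxcol0 scaler0 addr0.
  by rewrite !mxcolK zN_nth_lin; apply/colP => k; rewrite !mxE.
- rewrite -mxcol_lin; apply/eq_mxcol => t; rewrite /xN /xi /concat -mxcol_lin.
  apply/eq_mxcol => j; rewrite -keep_lin; congr keep; case: ifP => _.
    by rewrite !submxcol0 scaler0 addr0.
  by rewrite !mxcolK zN_nth_lin; apply/colP => k; rewrite !mxE.
- rewrite -mxcol_lin; apply/eq_mxcol => t; rewrite /xi /concat; case: ifP => _.
    by rewrite !submxcol0 scaler0 addr0.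
  by rewrite !mxcolK zN_nth_lin; apply/colP => k; rewrite !mxE.
Qed.

Lemma unkeepK (b : bool) p (v : 'cV[R]_p) : b -> unkeep (keep b v) = v.
Proof. by move=> ->. Qed.

Lemma zN_nthK (i j : 'I_N) (z : 'cV[R]_(@ztot R G Td T Tini)) : (i == j) || edge i j ->
  zN_nth (zN i z) j = submxcol z j.
Proof. by move=> e; rewrite /zN_nth /zN mxcolK unkeepK. Qed.

Lemma AcalE uini xini (z : 'cV[R]_(@ztot R G Td T Tini)) :
  Acal Td T Tini ud xd *m z = \mxcol_i node_b T Tini uini xini i <->
  P_feasible ud xd uini xini (fun i => z_g (submxcol z i))
    (u_of (G:=G) (submxcol z)) (x_of (submxcol z)).
Proof.
have -> : Acal Td T Tini ud xd *m z = \mxcol_i node_lhs ud xd (zN i z).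
  by rewrite /Acal mxcol_mul; apply/eq_mxcol => i; rewrite -mulmxA FmxE node_AE.
suff H i : node_lhs ud xd (zN i z) = node_b T Tini uini xini i <->
   Hmx Td T Tini ud xd i *m z_g (submxcol z i) =
     hstack T Tini i (concat Tini uini (u_of (submxcol z)))
            (concat Tini xini (x_of (submxcol z))) /\
   xi i (x_of (submxcol z)) T = 0.
  split=> [/eq_mxcolP h i|h]; first exact/H/h.
  by apply/eq_mxcol => i; apply/H/h.
rewrite /node_lhs /node_b zN_nthK ?eqxx //.
have -> : hstack T Tini i (concat Tini (fun=> 0) (u_of (zN_nth (zN i z))))
     (concat Tini (fun=> 0) (x_of (zN_nth (zN i z)))) =
   hstack T Tini i (concat Tini uini (u_of (submxcol z)))
            (concat Tini xini (x_of (submxcol z))) -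
   hstack T Tini i (concat Tini uini (fun=> 0)) (concat Tini xini (fun=> 0)).
  rewrite /hstack !opp_col_mx !add_col_mx; congr (col_mx _ (col_mx _ _)).
  - rewrite -scaleN1r addrC -mxcol_lin; apply/eq_mxcol => t; rewrite /ui /concat.
    case: ifP => _; first by rewrite submxcol0 scaleN1r addNr.
    by rewrite !mxcolK submxcol0 scaler0 add0r zN_nthK ?eqxx.
  - rewrite -scaleN1r addrC -mxcol_lin; apply/eq_mxcol => t; rewrite /xN -mxcol_lin.
    apply/eq_mxcol => j; rewrite -keep_lin /xi /concat.
    have [e|//] := boolP (edge i j); rewrite /keep.
    case: ifP => _; first by rewrite submxcol0 scaleN1r addNr.
    by rewrite !mxcolK submxcol0 scaler0 add0r zN_nthK ?e ?orbT.
  - rewrite -scaleN1r addrC -mxcol_lin; apply/eq_mxcol => t; rewrite /xi /concat.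
    case: ifP => _; first by rewrite submxcol0 scaleN1r addNr.
    by rewrite !mxcolK submxcol0 scaler0 add0r zN_nthK ?eqxx.
rewrite /xi /x_of mxcolK; split.
  move/eq_col_mx => [+ ->]; rewrite opprB addrA addrAC => /eqP.
  by rewrite -subr_eq0 addrK subr_eq0 => /eqP.
by move=> [-> ->]; rewrite opprB addrC subrK.
Qed.

Lemma quad_mxdiag n (d : 'I_n -> nat) (D : forall t, 'M[R]_(d t))
    (v : 'cV[R]_(\sum_t d t)) :
  (v^T *m \mxdiag_t D t *m v) 0 0
    = \sum_t ((submxcol v t)^T *m D t *m submxcol v t) 0 0.
Proof.
rewrite -{1 2}[v]submxcolK -mulmxA mul_mxdiag_mxcol tr_mxcol mul_mxrow_mxcol.
by rewrite summxE; apply: eq_bigr => t _; rewrite mulmxA.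
Qed.

Lemma quad_block_mx p q (D1 : 'M[R]_p) (D2 : 'M[R]_q) (v : 'cV[R]_(p + q)) :
  (v^T *m block_mx D1 0 0 D2 *m v) 0 0
    = ((usubmx v)^T *m D1 *m usubmx v) 0 0
      + ((dsubmx v)^T *m D2 *m dsubmx v) 0 0.
Proof.
rewrite -{1 2}[v]vsubmxK tr_col_mx mul_row_block !mulmx0 addr0 add0r.
by rewrite mul_row_col mxE.
Qed.

Lemma wnorm_sqr p (Q : 'M[R]_p) v : psd Q ->
  wnorm Q v ^+ 2 = (v^T *m Q *m v) 0 0.
Proof. by move=> [_ Q0]; rewrite sqr_sqrtr. Qed.

Lemma pd_psd p (Q : 'M[R]_p) : pd Q -> psd Q.
Proof.
move=> [QT Q0]; split=> // v; have [->|/Q0/ltW//] := eqVneq v 0.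
by rewrite mulmx0 mxE.
Qed.

Lemma node_QE (Q : forall i : 'I_N, 'M[R]_(xdim i))
    (W : forall i : 'I_N, 'M[R]_(udim i)) (i : 'I_N)
    (z : 'cV[R]_(@zdim R G Td T Tini i)) u x : psd (Q i) -> psd (W i) ->
  (forall t, (t < T)%N -> ui i u t = z_u z t /\ xi i x t = z_x z t) ->
  wnorm (node_Q Td T Tini Q W i) z ^+ 2 = node_cost Q W T i u x.
Proof.
move=> Qi Wi uz.
have -> : wnorm (node_Q Td T Tini Q W i) z ^+ 2
    = (z^T *m node_Q Td T Tini Q W i *m z) 0 0; last first.
  rewrite quad_block_mx mulmx0 mul0mx mxE add0r quad_block_mx !quad_mxdiag.
  rewrite -big_split !big_ord_recr /= ltnn !mulmx0 !mul0mx !mxE !addr0.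
  apply: eq_bigr => t _; have [ut xt] := uz t (ltn_ord t).
  rewrite !ltn_ord !wnorm_sqr // ut xt addrC /z_u /z_x /sample.
  by have -> : widen_ord (leqnSn T) t = inord t by apply/val_inj; rewrite /= inordK // ltnS ltnW.
rewrite sqr_sqrtr // quad_block_mx mulmx0 mul0mx mxE add0r quad_block_mx.
have [[_ Q0] [_ W0]] := (Qi, Wi).
rewrite !quad_mxdiag addr_ge0 // sumr_ge0 // => t _; case: ifP => // _;
by rewrite mulmx0 mul0mx mxE.
Qed.
End Correctness.

(* Main.v *)
Require Import Defs.
From HB Require Import structures.
From mathcomp Require Import all_boot all_order all_algebra.
From mathcomp Require Import all_classical all_reals all_analysis.
From mathcomp Require Import zify ring lra.

Set Implicit Arguments.
Unset Strict Implicit.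
Unset Printing Implicit Defensive.

Import Order.TTheory GRing.Theory Num.Theory.
Import numFieldNormedType.Exports.
Local Open Scope ring_scope.

(** The vector field of the flow is affine: [M *m y - col_mx 0 b].  It has a zero
    [ys] because [b] is in the range of the constraint matrix.  With
    [w := mp_pinv M *m (M *m (y - ys))], the point [y - w] is again a saddle point
    and [w] is at most [opnorm2 (mp_pinv M)] times as long as the velocity.  By
    the fundamental lemma of Willems et al. (for the whole network in case (i),
    for each node driven by its input and its neighbours in case (ii)),
    feasibility in (P) and in (L) coincide, so every saddle point has the input
    component [ustar]; hence the input error is a part of [w]. *)

(** * The fundamental lemma *)

(** The leading coefficient [p n = 1] is exposed because the arguments below solve for the highest
    power. *)
Lemma Cayley_Hamilton_coef (F : fieldType) n (A : 'M[F]_n) :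
  exists p : nat -> F, p n = 1 /\ \sum_(j < n.+1) p j *: A ^+ j = 0.
Proof.
case: n A => [|n] A; first by exists (fun=> 1); split=> //; exact: flatmx0.
exists (fun j => (char_poly A)`_j); split.
  by have /monicP := char_poly_monic A; rewrite lead_coefE size_char_poly.
rewrite -[RHS](Cayley_Hamilton A) -{2}[char_poly A]coefK poly_def size_char_poly.
rewrite linear_sum; apply: eq_bigr => j _.
by rewrite linearZ /= rmorphXn /= horner_mx_X.
Qed.

(** For [l >= n], multiplying the Cayley-Hamilton identity by [A ^+ (l - n)] expresses [A ^+ l] by
    lower powers; strong induction concludes. *)
Lemma krylov_all (F : fieldType) n m (A : 'M[F]_n) (B : 'M[F]_(n, m)) (v : 'rV[F]_n) :
  (forall l, (l < n)%N -> v *m A ^+ l *m B = 0) ->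
  forall l, v *m A ^+ l *m B = 0.
Proof.
move=> v0; have [p [pn ps]] := Cayley_Hamilton_coef A.
elim/ltn_ind => l IH; have [/v0//|nl] := ltnP l n.
have : v *m (\sum_(j < n.+1) p j *: A ^+ j) *m A ^+ (l - n) *m B = 0.
  by rewrite ps mulmx0 !mul0mx.
rewrite mulmx_sumr !mulmx_suml big_ord_recr /= pn scale1r.
rewrite -[v *m _ *m _]mulmxA -[A ^+ n *m _]exprD subnKC // big1 ?add0r // => j _.
rewrite -scalemxAr -!scalemxAl -[v *m _ *m _]mulmxA -[A ^+ j *m _]exprD IH ?scaler0 //.
by have := ltn_ord j; lia.
Qed.

Definition annihilates_windows (R : realType) Td k (w : nat -> 'cV[R]_k) t
    (c : nat -> 'rV[R]_k) : Prop :=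
  forall b, (b + t <= Td)%N -> \sum_(s < t) c s *m w (b + s)%N = 0.

(** Full row rank of the Hankel matrix, read as a trivial left kernel; coefficients indexed by [nat]
    keep time shifts free of casts. *)
Definition exciting (R : realType) Td k (w : nat -> 'cV[R]_k) t : Prop :=
  forall c, annihilates_windows Td w t c -> forall s, (s < t)%N -> c s = 0.

Lemma eq_tstackP (R : realType) L k (w1 w2 : nat -> 'cV[R]_k) :
  tstack L w1 = tstack L w2 <-> forall t, (t < L)%N -> w1 t = w2 t.
Proof.
split=> [w12 t tL|w12]; last by apply/eq_mxcol => t; exact: w12.
by have := congr1 (fun v => submxcol v (Ordinal tL)) w12; rewrite !mxcolK.
Qed.

Lemma mul_hankel (R : realType) Td L k (w : nat -> 'cV[R]_k) (g : 'cV[R]_(Td.+1 - L)) :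
  hankel Td L w *m g = tstack L (fun t => \sum_b g b 0 *: w (t + b)%N).
Proof.
rewrite /hankel mxcol_mul; apply/eq_mxcol => t; apply/colP => r.
by rewrite mxE summxE; apply: eq_bigr => b _; rewrite !mxE mulrC.
Qed.

Lemma mul_mxrow_hankel (R : realType) Td L k (w : nat -> 'cV[R]_k) (c : nat -> 'rV[R]_k)
    (b : 'I_(Td.+1 - L)) :
  (\mxrow_(s < L) c s *m hankel Td L w) 0 b
    = (\sum_(s < L) c s *m w (b + s)%N) 0 0.
Proof.
rewrite mul_mxrow_mxcol !summxE; apply: eq_bigr => s _.
by rewrite !mxE; apply: eq_bigr => r _; rewrite !mxE addnC.
Qed.

Lemma persistently_exciting_exciting (R : realType) Td k (w : nat -> 'cV[R]_k) t :
  persistently_exciting Td w t -> exciting Td w t.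
Proof.
move=> wt c c0 s st; have free : row_free (hankel Td t w).
  by rewrite /row_free wt sum_nat_const card_ord mulnC.
have /eqP : \mxrow_(s < t) c s *m hankel Td t w = 0.
  apply/rowP => b; rewrite mul_mxrow_hankel c0 ?mxE //.
  by have := ltn_ord b; lia.
rewrite mulmx_free_eq0 // => /eqP /(congr1 (fun v => submxrow v (Ordinal st))).
by rewrite mxrowK submxrow0.
Qed.

Section FundamentalLemma.
Context (R : realType) (n m : nat) (A : 'M[R]_n) (B : 'M[R]_(n, m)) (Td : nat).
Context (u : nat -> 'cV[R]_m) (x : nat -> 'cV[R]_n).
Context (dyn : forall t, (t.+1 < Td)%N -> x t.+1 = A *m x t + B *m u t).

(* The coefficients of the relation obtained from
   [v x(b) + \sum_(s < L) eta_s u(b + s) = 0] by shifting time j times and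
   eliminating x(b+1), ..., x(b+j) with the dynamics. *)
Let shifted L (v : 'rV[R]_n) (eta : nat -> 'rV[R]_m) j s : 'rV[R]_m :=
  if (s < j)%N then v *m A ^+ (j - s.+1) *m B
  else if (s < j + L)%N then eta (s - j)%N else 0.

(** Relation [j] at time [b + 1] becomes relation [j + 1] at time [b] once [x b.+1] is replaced by
    the dynamics. *)
Lemma shifted_rel L v (eta : nat -> 'rV[R]_m) : (0 < L)%N ->
  (forall b, (b + L <= Td)%N -> v *m x b + \sum_(s < L) eta s *m u (b + s)%N = 0) ->
  forall j b, (b + (j + L) <= Td)%N ->
    v *m A ^+ j *m x b + \sum_(s < j + L) shifted L v eta j s *m u (b + s)%N = 0.
Proof.
move=> L0 rel; elim=> [|j IH] b bL.
  rewrite expr0 mulmx1 -[RHS](rel b bL); congr (_ + _); apply: eq_bigr => s _.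
  by rewrite /shifted ltn0 subn0 ltn_ord.
rewrite -[RHS](IH b.+1); last lia.
(* [0 < L] leaves room in the data for the step from [b] to [b + 1]. *)
rewrite dyn; last lia.
rewrite addSn big_ord_recl addn0 mulmxDr addrA; congr (_ + _ + _).
- by rewrite exprSr -[A ^+ j * A]/(A ^+ j *m A) !mulmxA.
- by rewrite /shifted /= subSS subn0 !mulmxA.
- apply: eq_bigr => s _; rewrite addnS -(addSn b s); congr (_ *m _).
Qed.

(* Weighting the n + 1 shifted relations by the characteristic polynomial of A
   removes the state; excitation kills the resulting relation between inputs,
   and as the polynomial is monic its coefficients vanish from the top down. *)
Lemma exciting_relation_trivial L v (eta : nat -> 'rV[R]_m) :
  (0 < L)%N -> exciting Td u (n + L) ->
  (forall b, (b + L <= Td)%N -> v *m x b + \sum_(s < L) eta s *m u (b + s)%N = 0) ->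
  (forall l, v *m A ^+ l *m B = 0) /\ forall s, (s < L)%N -> eta s = 0.
Proof.
move=> L0 PE rel; have [p [pn ps]] := Cayley_Hamilton_coef A.
pose sh := shifted L v eta; pose E := sh n.
(* All families are one sequence [E] aligned at its right end. *)
have EE j s : (j <= n)%N -> sh j s = E (s + (n - j))%N.
  move=> jn. rewrite /E /sh /shifted.
  have -> : (s + (n - j) < n = (s < j))%N by lia.
  have -> : (s + (n - j) < n + L = (s < j + L))%N by lia.
  have -> : (n - (s + (n - j)).+1 = j - s.+1)%N by lia.
  by have -> : (s + (n - j) - n = s - j)%N by lia.
(* Relation [j] is padded by zeros from length [j + L] to [n + L]; the weighted state terms cancel
   by Cayley-Hamilton, so excitation applies. *)
have rec s : (s < n + L)%N -> \sum_(j < n.+1) p j *: sh j s = 0.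
  apply: (PE (fun s => \sum_(j < n.+1) p j *: sh j s)) => b bL.
  under eq_bigr do rewrite mulmx_suml.
  rewrite exchange_big /=.
  transitivity (\sum_(j < n.+1) p j *: (- (v *m A ^+ j *m x b))); last first.
    under eq_bigr do rewrite scalerN scalemxAl scalemxAr.
    by rewrite sumrN -mulmx_suml -mulmx_sumr ps mulmx0 mul0mx oppr0.
  apply: eq_bigr => j _; have jn : (j <= n)%N by rewrite -ltnS.
  have bj : (b + (j + L) <= Td)%N by lia.
  have /eqP := shifted_rel L0 rel bj; rewrite addrC addr_eq0 => /eqP <-.
  rewrite scaler_sumr.
  rewrite [RHS](big_ord_widen _ (fun s => p j *: (shifted L v eta j s *m u (b + s)%N)) (_ : _ <= n + L)%N); last lia.
  rewrite [RHS]big_mkcond /=; apply: eq_bigr => s' _; rewrite -scalemxAl.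
  case: ifP => // sj; rewrite /sh /shifted sj.
  by case: ifP => [|_]; [lia | rewrite mul0mx scaler0].
(* Descending induction on [s]: the term [j = n] of [rec] is [E s], and the terms [j < n] are values
   of [E] at larger indices. *)
have E0 d s : (n + L <= s + d)%N -> E s = 0.
  elim: d s => [|d IH] s sd; have [sL|sL] := leqP (n + L) s.
  - by rewrite /E /sh /shifted ltnNge (leq_trans _ sL) ?leq_addr //= ltnNge sL.
  - by lia.
  - by rewrite /E /sh /shifted ltnNge (leq_trans _ sL) ?leq_addr //= ltnNge sL.
  - have := rec s sL; rewrite big_ord_recr /= pn scale1r EE // subnn addn0.
    rewrite big1 ?add0r // => j _.
    by rewrite EE ?(ltnW (ltn_ord _)) // IH ?scaler0 //; have := ltn_ord j; lia.
(* The first [n] values of [E] are [v *m A ^+ l *m B], with [l] running down from [n - 1]; the next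
   [L] are those of [eta]. *)
split=> [|s sL].
  apply: krylov_all => l ln; rewrite -[RHS](E0 (n + L)%N (n - l.+1)%N) ?leq_addl //.
  rewrite /E /sh /shifted ifT; last lia.
  by congr (_ *m _ ^+ _ *m _); lia.
rewrite -[RHS](E0 (n + L)%N (n + s)%N) ?leq_addl //.
by rewrite /E /sh /shifted ltnNge leq_addr /= ltn_add2l sL addKn.
Qed.

(** The data states at the window starts, stacked on the input windows, form a matrix of full row
    rank, by [exciting_relation_trivial] and reachability. So some [g] matches the initial state and
    all inputs of the given trajectory; the dynamics propagate the match to the later states. *)
Theorem fundamental_lemma L (ub : nat -> 'cV[R]_m) (xb : nat -> 'cV[R]_n) :
  (0 < L)%N -> exciting Td u (n + L) ->
  (forall v : 'rV[R]_n, (forall l, v *m A ^+ l *m B = 0) -> v = 0) ->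
  (forall t, (t.+1 < L)%N -> xb t.+1 = A *m xb t + B *m ub t) ->
  exists g : 'cV[R]_(Td.+1 - L), forall t, (t < L)%N ->
    ub t = \sum_b g b 0 *: u (t + b)%N /\ xb t = \sum_b g b 0 *: x (t + b)%N.
Proof.
move=> L0 PE reach dynb.
pose X : 'M[R]_(n, Td.+1 - L) := \matrix_(r, b) x b r 0.
pose H := col_mx X (hankel Td L u).
have freeH : row_free H.
  rewrite -kermx_eq0; apply/eqP/row_matrixP => i; rewrite row0; set w := row i _.
  have : w *m H = 0 by apply/sub_kermxP; exact: row_sub.
  rewrite -[w]hsubmxK mul_row_col; move: (lsubmx w) (rsubmx w) => v e.
  pose eta s := if insub s is Some t then submxrow e t else 0 : 'rV[R]_m.
  have -> : e = \mxrow_(s < L) eta s.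
    by rewrite -[LHS]submxrowK; apply/eq_mxrow => s; rewrite /eta valK.
  move=> /rowP rel.
  have [//|v0 e0] := @exciting_relation_trivial L v eta L0 PE.
    move=> b bL; apply/matrixP => r q; rewrite !ord1.
    have bL' : (b < Td.+1 - L)%N by lia.
    have := rel (Ordinal bL'); rewrite mxE mul_mxrow_hankel [RHS]mxE => h; rewrite mxE [RHS]mxE -h.
    by congr (_ + _); rewrite !mxE; apply: eq_bigr => k _; rewrite mxE.
  rewrite (reach _ v0); suff -> : \mxrow_(s < L) eta s = 0 by rewrite row_mx0.
  by apply/mxrowP => s; rewrite mxrowK submxrow0 e0.
pose g := pinvmx H *m col_mx (xb 0%N) (tstack L ub).
have : H *m g = col_mx (xb 0%N) (tstack L ub) by rewrite mulmxA mulmxVp ?mul1mx.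
rewrite mul_col_mx => /eq_col_mx [gX gU]; exists g.
have gu t : (t < L)%N -> ub t = \sum_b g b 0 *: u (t + b)%N.
  by move: gU; rewrite mul_hankel => /eq_tstackP/[apply] ->.
elim=> [|t IH] tL; split; try exact: gu.
  rewrite -gX; apply/colP => r; rewrite summxE mxE.
  by apply: eq_bigr => b _; rewrite !mxE mulrC.
have [ut xt] := IH (ltnW tL).
rewrite dynb // ut xt !mulmx_sumr -big_split; apply: eq_bigr => b _ /=.
by rewrite -!scalemxAr -scalerDr addSn dyn //; have := ltn_ord b; lia.
Qed.
End FundamentalLemma.

(** * Saddle points, norms and gradients *)

(** With [w := Q *m x], nonnegativity of the form at [x + t *: w] reads
    [0 <= 2 * t * a + t ^+ 2 * c], where [a] is the squared length of [w]; a small negative [t]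
    forces [a = 0]. *)
Lemma psd_ker (R : realType) p (Q : 'M[R]_p) (x : 'cV[R]_p) :
  psd Q -> (x^T *m Q *m x) 0 0 = 0 -> Q *m x = 0.
Proof.
move=> [QT Q0] xQ; pose w := Q *m x.
pose c : R := (w^T *m Q *m w) 0 0; pose a : R := (w^T *m w) 0 0.
have c0 : 0 <= c by exact: Q0.
have key t : 0 <= 2 * t * a + t ^+ 2 * c.
  have := Q0 (x + t *: w).
  have -> : (x + t *: w)^T *m Q *m (x + t *: w) = x^T *m Q *m x
      + (2 * t) *: (w^T *m w) + t ^+ 2 *: (w^T *m Q *m w).
    have -> : (x + t *: w)^T = x^T + t *: w^T by rewrite linearD linearZ.
    rewrite !mulmxDl !mulmxDr -!scalemxAl -!scalemxAr.
    have -> : x^T *m Q *m w = w^T *m w by rewrite -{1}QT -trmx_mul.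
    have -> : w^T *m Q *m x = w^T *m w by rewrite -mulmxA.
    move: (x^T *m Q *m x) (w^T *m w) (w^T *m Q *m w) => P1 P2 P3.
    by apply/matrixP => i k; rewrite !mxE; ring.
  by rewrite [X in 0 <= X]mxE [X in 0 <= X + _]mxE xQ add0r [X in X + _]mxE [X in _ + X]mxE.
have a0 : 0 <= a.
  by rewrite /a mxE sumr_ge0 // => i _; rewrite mxE -expr2 sqr_ge0.
have aE : a = 0.
  move: a c c0 key a0 => {}a {}c c0 key a0; clear -c0 key a0.
  (* At [t = - s] the inequality becomes [0 <= - s ^+ 2 * (c + 2)]; the added 1 keeps the
     denominator positive. *)
  have := key (- (a / (c + 1))); set s := a / (c + 1).
  have sE : s * (c + 1) = a by rewrite /s divfK //; lra.
  have s0 : 0 <= s by rewrite divr_ge0 //; lra.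
  nra.
apply: trmx_inj; rewrite trmx0; apply: gram_eq0; rewrite trmxK.
by apply/matrixP => i j; rewrite !ord1 -/w [LHS]aE mxE.
Qed.

(* By the Fredholm alternative: a vector of the left kernel of the KKT matrix
   has primal part in the kernels of [Q] and [A], hence it is orthogonal to
   [col_mx 0 (A *m z0)]. *)
Lemma saddle_point_exists (R : realType) p c (Q : 'M[R]_p) (A : 'M[R]_(c, p)) z0 :
  psd Q -> exists y : 'cV[R]_(p + c),
    block_mx (- (2%:R *: Q^T)) (- A^T) A 0 *m y = col_mx 0 (A *m z0).
Proof.
move=> Qpsd; have [QT Q0] := Qpsd; set K := block_mx _ _ _ _.
set v := col_mx _ _.
suff : (v^T <= K^T)%MS.
  move=> /submxP[D /(congr1 trmx)]; rewrite trmx_mul !trmxK => ->.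
  by exists D^T.
rewrite submxE; apply/eqP/trmx_inj/row_matrixP => j.
rewrite trmx_mul trmxK row_mul trmx0 row0; set w := row j _.
have : K^T *m w^T = 0 by rewrite /w tr_row trmxK colE mulmxA mulmx_coker mul0mx.
rewrite -[w]trmxK; move: (w^T) => {w} w.
rewrite -[w]vsubmxK; move: (usubmx w) (dsubmx w) => x mu.
rewrite /K tr_block_mx !linearN linearZ /= !trmxK trmx0 mul_block_col.
rewrite mul0mx addr0 !mulNmx -[0]vsubmxK => /eq_col_mx[].
rewrite !linear0 -scalemxAl => xmu /eqP; rewrite oppr_eq0 => /eqP Ax.
(* Multiplying [xmu] by [x^T] kills its [mu] term since [A *m x = 0], leaving
   [x^T *m Q *m x = 0]. *)
have Qx : Q *m x = 0.
  apply: psd_ker => //; have := congr1 (mulmx x^T) xmu.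
  rewrite mulmx0 mulmxDr mulmxN -scalemxAr (mulmxA _ A^T) -trmx_mul Ax trmx0 mul0mx addr0.
  by move=> /eqP; rewrite oppr_eq0 scaler_eq0 pnatr_eq0 /= => /eqP; rewrite mulmxA => ->; rewrite mxE.
move: xmu; rewrite Qx scaler0 oppr0 add0r => Amu.
rewrite tr_col_mx mul_row_col mulmx0 add0r mulmxA -[A]trmxK -trmx_mul Amu.
by rewrite trmx0 mul0mx.
Qed.

(** * Euclidean norms, the induced operator norm and directional derivatives *)

Lemma norm2_ge0 (R : realType) p (v : 'cV[R]_p) : 0 <= norm2 v.
Proof. exact: sqrtr_ge0. Qed.

Lemma sqr_norm2_sum (R : realType) p (v : 'cV[R]_p) :
  norm2 v ^+ 2 = \sum_i v i 0 ^+ 2.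
Proof. by rewrite sqr_sqrtr // sumr_ge0 // => i _; exact: sqr_ge0. Qed.

Lemma sqr_norm2 (R : realType) p (v : 'cV[R]_p) : norm2 v ^+ 2 = (v^T *m v) 0 0.
Proof.
by rewrite sqr_norm2_sum mxE; apply: eq_bigr => i _; rewrite mxE expr2.
Qed.

Lemma sqr_norm2_col_mx (R : realType) p q (v : 'cV[R]_p) (w : 'cV[R]_q) :
  norm2 (col_mx v w) ^+ 2 = norm2 v ^+ 2 + norm2 w ^+ 2.
Proof. by rewrite !sqr_norm2 tr_col_mx mul_row_col mxE. Qed.

Lemma sqr_norm2_blocks (R : realType) n (d : 'I_n -> nat) (v : 'cV[R]_(\sum_i d i)) :
  norm2 v ^+ 2 = \sum_i norm2 (submxcol v i) ^+ 2.
Proof.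
rewrite sqr_norm2 -[v]submxcolK tr_mxcol mul_mxrow_mxcol summxE.
by apply: eq_bigr => i _; rewrite mxcolK -sqr_norm2.
Qed.

Lemma norm2Z (R : realType) p (a : R) (v : 'cV[R]_p) : norm2 (a *: v) = `|a| * norm2 v.
Proof.
apply/eqP; rewrite -(@eqrXn2 _ 2) ?mulr_ge0 ?norm2_ge0 //.
rewrite exprMn !sqr_norm2_sum mulr_sumr real_normK ?num_real //.
by apply/eqP; apply: eq_bigr => i _; rewrite mxE exprMn.
Qed.

Lemma norm2_eq0 (R : realType) p (v : 'cV[R]_p) : norm2 v = 0 -> v = 0.
Proof.
move=> v0; apply: trmx_inj; rewrite trmx0; apply: gram_eq0; rewrite trmxK.
by apply/matrixP => i j; rewrite !ord1 -sqr_norm2 v0 expr0n mxE.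
Qed.

(** Makes the supremum in [opnorm2] an upper bound. Entries of a vector in the unit ball are at most
    1 in absolute value, so the absolute row sums of [M] dominate the entries of [M *m x]. *)
Lemma opnorm2_bounded (R : realType) p q (M : 'M[R]_(p, q)) :
  has_ubound [set norm2 (M *m x) | x in [set x : 'cV[R]_q | norm2 x <= 1]]%classic.
Proof.
exists (Num.sqrt (\sum_i (\sum_j `|M i j|) ^+ 2)) => _ [x /= x1 <-].
apply: ler_wsqrtr; apply: ler_sum => i _.
rewrite -real_normK ?num_real // lerXn2r ?nnegrE ?normr_ge0 ?sumr_ge0 //.
rewrite mxE (le_trans (ler_norm_sum _ _ _)) //; apply: ler_sum => j _.
rewrite normrM -[leRHS]mulr1 ler_wpM2l // (le_trans _ x1) //.
rewrite -sqrtr_sqr; apply: ler_wsqrtr.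
by rewrite (bigD1 j) //= lerDl sumr_ge0 // => k _; exact: sqr_ge0.
Qed.

Lemma norm2_mulmx (R : realType) p q (M : 'M[R]_(p, q)) (x : 'cV[R]_q) :
  norm2 (M *m x) <= opnorm2 M * norm2 x.
Proof.
have [x0|x0] := eqVneq (norm2 x) 0.
  rewrite x0 mulr0 (norm2_eq0 x0) mulmx0.
  by rewrite /norm2 big1 ?sqrtr0 // => i _; rewrite mxE expr0n.
have xgt0 : 0 < norm2 x by rewrite lt0r x0 norm2_ge0.
rewrite -ler_pdivrMr // mulrC -[_^-1]ger0_norm ?invr_ge0 ?norm2_ge0 //.
rewrite -norm2Z scalemxAr; apply: ub_le_sup; first exact: opnorm2_bounded.
exists ((norm2 x)^-1 *: x) => //=.
by rewrite norm2Z ger0_norm ?invr_ge0 ?norm2_ge0 // mulVf.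
Qed.

(** For [h != 0] the difference quotient is exactly [a + h * c], which tends to [a]. *)
Lemma derive_quadratic (R : realType) p (f : 'cV[R]_p -> R) v w (a c : R) :
  (forall h : R, f (h *: w + v) = f v + h * a + h ^+ 2 * c) -> ('D_w f v)%classic = a.
Proof.
move=> fE; apply: cvg_lim; first exact: Rhausdorff.
suff : ((a + h * c) @[h --> 0^'] --> a)%classic.
  apply: cvg_trans; apply: near_eq_cvg; near=> h.
  have h0 : h != 0 by near: h; exact: nbhs_dnbhs_neq.
  by rewrite /= fE /GRing.scale /=; field.
have : ((a + h * c) @[h --> (0 : R)^'] --> a + 0 * c)%classic.
  apply: cvg_within_filter.
  by apply: cvgD; [exact: cvg_cst | apply: cvgMl; exact: cvg_id].
by rewrite mul0r addr0.
Unshelve. all: by end_near.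
Qed.

(** * Trajectories of the network and data *)

Section NetworkSystem.
Context (R : realType) (G : network R).
Local Notation N := (nnode G).

(** The network is steered from 0 to [v^T]. Along the way every [v *m Amx G ^+ l] annihilates the
    state, hence [v *m v^T = 0]. *)
Lemma controllable_reach : controllable G ->
  forall v : 'rV[R]_(nx G), (forall l, v *m Amx G ^+ l *m Bmx G = 0) -> v = 0.
Proof.
move=> ctrl v v0; apply: trmx_inj; rewrite trmx0.
have [L [u [x [x0 xL dyn]]]] := ctrl 0 v^T.
have vx t : (t <= L)%N -> forall l, v *m Amx G ^+ l *m x t = 0.
  elim: t => [|t IH] tL l; first by rewrite x0 mulmx0.
  rewrite dyn // mulmxDr !mulmxA v0 mul0mx addr0.
  by rewrite -[v *m _ *m Amx G]mulmxA -[_ *m Amx G]exprSr IH // ltnW.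
have := vx L (leqnn L) 0%N; rewrite expr0 mulmx1 xL => vv.
by rewrite (gram_eq0 vv) trmx0.
Qed.

(* The inputs of node [i], seen as a system on its own, are [u_i] and the
   states of its neighbours. *)
Definition node_input_map (i : 'I_N) (w : 'cV[R]_(udim i + ndim i)) : 'cV[R]_(xdim i) :=
  Bblk i *m usubmx w
  + \sum_(j < N | edge i j) Ablk i j *m unkeep (submxcol (dsubmx w) j).

Definition node_input_mx (i : 'I_N) : 'M[R]_(xdim i, udim i + ndim i) :=
  mx_of (@node_input_map i).

Definition node_input i (u : nat -> 'cV[R]_(nu G)) x t : 'cV[R]_(udim i + ndim i) :=
  col_mx (ui i u t) (xN i x t).

Lemma node_input_mxE i w : node_input_mx i *m w = node_input_map w.
Proof.
apply: mx_ofE => a {}w w'; rewrite /node_input_map scalerDr addrACA scaler_sumr -big_split.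
congr (_ + _); first by rewrite linearP mulmxDr -scalemxAr.
apply: eq_bigr => j _ /=.
have -> : dsubmx (a *: w + w') = a *: dsubmx w + dsubmx w' by rewrite linearP.
by rewrite submxcol_lin unkeep_lin mulmxDr -scalemxAr.
Qed.

Lemma xN_nth i j (x : nat -> 'cV[R]_(nx G)) t : edge i j -> unkeep (submxcol (xN i x t) j) = xi j x t.
Proof. by move=> eij; rewrite mxcolK unkeepK. Qed.

Lemma node_dynamics i L (u : nat -> 'cV[R]_(nu G)) x : trajectory L u x ->
  forall t, (t.+1 < L)%N ->
  xi i x t.+1 = Ablk i i *m xi i x t + node_input_mx i *m node_input i u x t.
Proof.
move=> traj t tL; rewrite traj // node_input_mxE /node_input_map col_mxKu col_mxKd.
rewrite -addrA [_ + Bblk i *m _]addrC; congr (_ + (_ + _)).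
by apply: eq_bigr => j eij; rewrite xN_nth.
Qed.

Lemma unkeep_sum (I : finType) b p (a : I -> R) (v : I -> 'cV[R]_(if b then p else 0%N)) :
  unkeep (\sum_k a k *: v k) = \sum_k a k *: unkeep (v k).
Proof. by case: b v => //= v; rewrite big1 // => k _; rewrite scaler0. Qed.

Lemma keep_sum (I : finType) b p (a : I -> R) (v : I -> 'cV[R]_p) :
  keep b (\sum_k a k *: v k) = \sum_k a k *: keep b (v k).
Proof. by case: b => //=; rewrite big1 // => k _; rewrite scaler0. Qed.

Lemma submxcol_lincomb n (d : 'I_n -> nat) (I : finType) (a : I -> R)
    (v : I -> 'cV[R]_(\sum_i d i)) i :
  submxcol (\sum_k a k *: v k) i = \sum_k a k *: submxcol (v k) i.
Proof.
by rewrite submxcol_sum; apply: eq_bigr => k _; apply/colP => r; rewrite !mxE.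
Qed.

(** A node driven by its input and its neighbours inherits controllability: a network trajectory
    from 0 to a state with block [v^T] at node [i] is used as in [controllable_reach]. *)
Lemma node_reach i : controllable G ->
  forall v : 'rV[R]_(xdim i),
  (forall l, v *m Ablk i i ^+ l *m node_input_mx i = 0) -> v = 0.
Proof.
move=> ctrl v v0; apply: trmx_inj; rewrite trmx0.
(* [conform_mx] makes the target well typed at every node; only its value [v^T] at [i] matters. *)
have [L [u [x [x0 xL dyn]]]] := ctrl 0 (\mxcol_j conform_mx 0 v^T).
have traj : trajectory L.+1 u x by apply/trajectory_compact => t tL; exact: dyn.
have vx t : (t <= L)%N -> forall l, v *m Ablk i i ^+ l *m xi i x t = 0.
  elim: t => [|t IH] tL l; first by rewrite /xi x0 submxcol0 mulmx0.
  rewrite (node_dynamics i traj) // mulmxDr !mulmxA v0 mul0mx addr0.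
  by rewrite -[v *m _ *m Ablk i i]mulmxA -[_ *m Ablk i i]exprSr IH // ltnW.
have := vx L (leqnn L) 0%N; rewrite expr0 mulmx1 /xi xL mxcolK conform_mx_id => vv.
by rewrite (gram_eq0 vv) trmx0.
Qed.

(** Merges the two clauses of case (ii): outside [act G] the input block has dimension 0, so a
    relation on the node input is one on the neighbour states. *)
Lemma node_exciting i Td (u : nat -> 'cV[R]_(nu G)) x t :
  (i \in act G -> persistently_exciting Td (node_input i u x) t) ->
  (i \notin act G -> persistently_exciting Td (xN i x) t) ->
  exciting Td (node_input i u x) t.
Proof.
have [iS /(_ isT) PE _|iS _ /(_ isT) PE] := boolP (i \in act G).
  exact: persistently_exciting_exciting.
move=> c c0 s st; rewrite -[c s]hsubmxK.
have u0 q : lsubmx (c q) = 0.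
  by apply/rowP => k; have := ltn_ord k; rewrite [X in (_ < X)%N]udim_nact.
rewrite u0 (persistently_exciting_exciting PE (c := fun s => rsubmx (c s))) ?row_mx0 //.
move=> b bt; rewrite -[RHS](c0 b bt); apply: eq_bigr => q _.
by rewrite -[c q]hsubmxK mul_row_col u0 mul0mx add0r row_mxKr.
Qed.

Section Data.
Context (Td T Tini : nat) (ud : nat -> 'cV[R]_(nu G)) (xd : nat -> 'cV[R]_(nx G)).
Context (data_trajectory : trajectory Td ud xd).

Lemma Hmx_hstack i (g : 'cV[R]_(gdim Td T Tini)) u x :
  Hmx Td T Tini ud xd i *m g = hstack T Tini i u x <->
  forall t, (t < tau T Tini)%N ->
    [/\ ui i u t = \sum_b g b 0 *: ui i ud (t + b)%N,
        xN i x t = \sum_b g b 0 *: xN i xd (t + b)%N &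
        xi i x t = \sum_b g b 0 *: xi i xd (t + b)%N].
Proof.
rewrite /Hmx /hstack !mul_col_mx !mul_hankel; split.
  move=> /eq_col_mx[/eq_tstackP eu /eq_col_mx[/eq_tstackP eN /eq_tstackP ex]] t tt.
  by rewrite eu ?eN ?ex.
by move=> h; congr (col_mx _ (col_mx _ _)); apply/eq_tstackP => t /h[].
Qed.

(** The vectors [g i] may differ between nodes. Yet the neighbour block of node [i] holds the same
    signals [xi j x] as the stack of node [j], so the data dynamics at node [i], combined with the
    weights [g i], give the dynamics of [x] there. *)
Lemma Hmx_trajectory (g : 'I_N -> 'cV[R]_(gdim Td T Tini)) u x :
  (forall i, Hmx Td T Tini ud xd i *m g i = hstack T Tini i u x) ->
  trajectory (tau T Tini) u x.
Proof.
move=> Hg t tt i; have /Hmx_hstack gi := Hg i.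
have [_ _ ->] := gi _ tt; have [-> eN ->] := gi _ (ltnW tt).
have xj j : edge i j -> xi j x t = \sum_b g i b 0 *: xi j xd (t + b)%N.
  move=> eij; rewrite -(xN_nth _ _ eij) eN submxcol_lincomb unkeep_sum.
  by apply: eq_bigr => b _; rewrite xN_nth.
rewrite !mulmx_sumr; under [X in _ + X + _]eq_bigr => j eij do rewrite xj // mulmx_sumr.
rewrite exchange_big -!big_split; apply: eq_bigr => b _ /=.
rewrite addSn data_trajectory; last by have := ltn_ord b; rewrite /gdim; move: tt; rewrite /tau; lia.
rewrite !scalerDr scaler_sumr -!scalemxAr; congr (_ + _ + _).
by apply: eq_bigr => j _; rewrite scalemxAr.
Qed.

(** In case (i) a single [g] from the whole network serves all nodes; in case (ii) the fundamental
    lemma is applied to each node as a system of its own. *)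
Lemma trajectory_Hmx u x :
  controllable G ->
  persistently_exciting Td ud (nx G + tau T Tini)%N \/
  (forall i : 'I_N, i \in act G ->
     persistently_exciting Td (node_input i ud xd) (xdim i + tau T Tini)%N) /\
  (forall i : 'I_N, i \notin act G ->
     persistently_exciting Td (xN i xd) (xdim i + tau T Tini)%N) ->
  trajectory (tau T Tini) u x ->
  exists g : 'I_N -> 'cV[R]_(gdim Td T Tini),
    forall i, Hmx Td T Tini ud xd i *m g i = hstack T Tini i u x.
Proof.
have tau0 : (0 < tau T Tini)%N by rewrite /tau addn1.
move=> ctrl [PE|[PEact PEnact]] traj.
  have [g gP] := fundamental_lemma ((trajectory_compact _ _ _).1 data_trajectory) tau0
    (persistently_exciting_exciting PE) (controllable_reach ctrl)
    ((trajectory_compact _ _ _).1 traj).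
  exists (fun=> g) => i; apply/Hmx_hstack => t /gP[ut xt].
  have xt' j : xi j x t = \sum_b g b 0 *: xi j xd (t + b)%N.
    by rewrite /xi xt submxcol_lincomb.
  split=> //; first by rewrite /ui ut submxcol_lincomb.
  rewrite -[RHS]submxcolK; apply/eq_mxcol => j; rewrite xt' keep_sum submxcol_lincomb.
  by apply: eq_bigr => b _; rewrite mxcolK.
have node i : exists g : 'cV[R]_(gdim Td T Tini),
    Hmx Td T Tini ud xd i *m g = hstack T Tini i u x.
  have [g gP] := fundamental_lemma (node_dynamics i data_trajectory) tau0
    (node_exciting (@PEact i) (@PEnact i)) (node_reach ctrl) (node_dynamics i traj).
  exists g; apply/Hmx_hstack => t /gP[ut xt]; split=> //.
    rewrite -[LHS](col_mxKu _ (xN i x t)) -/(node_input i u x t) ut linear_sum.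
    by apply: eq_bigr => b _; rewrite linearZ /= col_mxKu.
  rewrite -[LHS](col_mxKd (ui i u t)) -/(node_input i u x t) ut linear_sum.
  by apply: eq_bigr => b _; rewrite linearZ /= col_mxKd.
by have [g gP] := choice node; exists g.
Qed.
End Data.
End NetworkSystem.

(** * The flow and the optimal input *)

Lemma sample_tstack (R : realType) L k (w : nat -> 'cV[R]_k) t :
  (t <= L)%N -> sample (tstack L.+1 w) t = w t.
Proof. by move=> tL; rewrite /sample mxcolK inordK. Qed.

Lemma concat_lt (R : realType) k L (w1 w2 : nat -> 'cV[R]_k) t :
  (t < L)%N -> concat L w1 w2 t = w1 t.
Proof. by rewrite /concat => ->. Qed.

Lemma concat_addl (R : realType) k L (w1 w2 : nat -> 'cV[R]_k) t :
  concat L w1 w2 (L + t)%N = w2 t.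
Proof. by rewrite /concat ltnNge leq_addr /= addKn. Qed.

Lemma psd_mxdiag (R : realType) n (d : 'I_n -> nat) (D : forall i, 'M[R]_(d i)) :
  (forall i, psd (D i)) -> psd (\mxdiag_i D i).
Proof.
move=> D0; split; first by rewrite tr_mxdiag; apply/eq_mxdiag => i; have [] := D0 i.
by move=> v; rewrite quad_mxdiag sumr_ge0 // => i _; have [_] := D0 i; exact.
Qed.

Lemma pd_mxdiag (R : realType) n (d : 'I_n -> nat) (D : forall i, 'M[R]_(d i)) :
  (forall i, pd (D i)) -> pd (\mxdiag_i D i).
Proof.
move=> D0; have Dpsd i := pd_psd (D0 i); have [DT Dge0] := psd_mxdiag Dpsd.
split=> // v; rewrite lt0r Dge0 andbT; apply: contraNneq => /eqP.
rewrite quad_mxdiag psumr_eq0 => [/allP v0|i _]; last by have [_] := Dpsd i; exact.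
apply/eqP/mxcolP => i; rewrite submxcol0; apply/eqP; have [_ Di] := D0 i.
by apply: contraTT (v0 i (mem_index_enum i)) => /Di /lt0r_neq0.
Qed.

Lemma psd_block_diag (R : realType) p q (D1 : 'M[R]_p) (D2 : 'M[R]_q) :
  psd D1 -> psd D2 -> psd (block_mx D1 0 0 D2).
Proof.
move=> [T1 P1] [T2 P2]; split; first by rewrite tr_block_mx !trmx0 T1 T2.
by move=> v; rewrite quad_block_mx addr_ge0.
Qed.

Lemma psd0 (R : realType) p : psd (0 : 'M[R]_p).
Proof. by split=> [|v]; rewrite ?trmx0 // mulmx0 mul0mx mxE. Qed.

Lemma grad_quadratic (R : realType) p c (Q : 'M[R]_p) (A : 'M[R]_(c, p)) b l v :
  Q^T = Q ->
  grad (fun v => (v^T *m Q *m v) 0 0 + (l^T *m (A *m v - b)) 0 0) v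
    = 2%:R *: (Q *m v) + A^T *m l.
Proof.
move=> QT; apply/colP => k; rewrite mxE; set e : 'cV_p := delta_mx k 0.
apply: (@derive_quadratic _ _ _ _ _ _ ((e^T *m Q *m e) 0 0)) => h.
have eE (w : 'cV[R]_p) : (e^T *m w) 0 0 = w k 0.
  by rewrite /e trmx_delta -rowE mxE.
have -> : (h *: e + v)^T = h *: e^T + v^T by rewrite linearP.
rewrite !mulmxDl !mulmxDr -!scalemxAl -!scalemxAr.
(* A 1 by 1 matrix equals its transpose, so with [Q] symmetric both cross terms coincide, whence the
   factor 2. *)
have -> : v^T *m Q *m e = (e^T *m (Q *m v))^T by rewrite !trmx_mul trmxK QT.
have -> : l^T *m (A *m e) = (e^T *m (A^T *m l))^T by rewrite !trmx_mul !trmxK mulmxA.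
rewrite -[e^T *m Q *m v]mulmxA -!eE mulmxDr -scalemxAr.
move: (e^T *m Q *m e) (e^T *m (Q *m v)) (v^T *m Q *m v) (e^T *m (A^T *m l)) => P1 P2 P3 P4.
move: (l^T *m (A *m v)) (l^T *m - b) => P5 P6.
by rewrite !mxE; ring.
Qed.

Lemma grad_affine (R : realType) p (a : R) (w v : 'cV[R]_p) :
  grad (fun l => a + (l^T *m w) 0 0) v = w.
Proof.
apply/colP => k; rewrite mxE; apply: (@derive_quadratic _ _ _ _ _ _ 0) => h.
have -> : (h *: delta_mx k 0 + v)^T = h *: (delta_mx k 0)^T + v^T by rewrite linearP.
by rewrite mulmxDl -scalemxAl trmx_delta -rowE !mxE; ring.
Qed.

Section DataProblem.
Context (R : realType) (G : network R).
Local Notation N := (nnode G).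
Context (Q : forall i : 'I_N, 'M[R]_(xdim i)) (W : forall i : 'I_N, 'M[R]_(udim i)).
Context (Td T Tini : nat) (ud : nat -> 'cV[R]_(nu G)) (xd : nat -> 'cV[R]_(nx G)).
Context (uini : nat -> 'cV[R]_(nu G)) (xini : nat -> 'cV[R]_(nx G)).

(** * Feasible points of (P) and (L) *)

Lemma lqr_feasible_trajectory u x :
  trajectory Tini uini xini -> lqr_feasible T Tini uini xini u x ->
  trajectory (tau T Tini) (concat Tini uini u) (concat Tini xini x).
Proof.
move=> /trajectory_compact ini [dyn x0 _]; apply/trajectory_compact => t tt.
(* The step lies inside the initial segment, after the junction, or at the junction, where the
   initial condition of (L) is the dynamics. *)
have [tT|tT|tT] := ltngtP t.+1 Tini.
- by rewrite !concat_lt ?ini // ltnW.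
- rewrite ltnS in tT; rewrite -(subnKC tT) -addnS !concat_addl dyn //; move: tt; rewrite /tau; lia.
- by rewrite /concat tT ltnn subnn x0 -tT ltnSn.
Qed.

Lemma trajectory_lqr_feasible u x : (0 < Tini)%N ->
  trajectory (tau T Tini) (concat Tini uini u) (concat Tini xini x) ->
  x T = 0 -> lqr_feasible T Tini uini xini u x.
Proof.
move=> Tini_gt0 /trajectory_compact traj xT; split=> // [t tT|].
  have := traj (Tini + t)%N; rewrite -addnS !concat_addl; apply.
  by rewrite /tau; lia.
have := traj Tini.-1; rewrite /concat prednK // ltnn subnn leqnn; apply.
by rewrite /tau; lia.
Qed.

Lemma P_feasible_lqr_feasible (g : 'I_N -> 'cV[R]_(gdim Td T Tini)) u x :
  (0 < Tini)%N -> trajectory Td ud xd -> P_feasible ud xd uini xini g u x ->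
  lqr_feasible T Tini uini xini u x.
Proof.
move=> Tini_gt0 data feas; apply: trajectory_lqr_feasible => //.
  by apply: (Hmx_trajectory data (g := g)) => i; have [] := feas i.
by apply/mxcolP => i; rewrite submxcol0; have [] := feas i.
Qed.

(** The constraints read [u] and [x] only up to time [T], which is all that [z] stores; beyond it
    [sample] is junk. *)
Lemma eq_P_feasible (g : 'I_N -> 'cV[R]_(gdim Td T Tini)) u x u' x' :
  (forall t, (t <= T)%N -> u t = u' t /\ x t = x' t) ->
  P_feasible ud xd uini xini g u x -> P_feasible ud xd uini xini g u' x'.
Proof.
move=> e feas i; have [gE xT] := feas i.
have [_ xTE] := e T (leqnn T); split; last by rewrite /xi -xTE.
have ec t : (t < tau T Tini)%N -> concat Tini uini u t = concat Tini uini u' t /\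
    concat Tini xini x t = concat Tini xini x' t.
  move=> tt; rewrite /concat; case: ltnP => // Tt; apply: e.
  by move: tt; rewrite /tau; lia.
rewrite gE /hstack; congr (col_mx _ (col_mx _ _)); apply/eq_tstackP => t /ec[eu ex].
- by rewrite /ui eu.
- by apply/eq_mxcol => j; rewrite /xi ex.
- by rewrite /xi ex.
Qed.

Definition z_of (g : 'I_N -> 'cV[R]_(gdim Td T Tini)) u x : 'cV[R]_(ztot G Td T Tini) :=
  \mxcol_i col_mx (g i) (col_mx (tstack T.+1 (ui i u)) (tstack T.+1 (xi i x))).

Lemma u_of_z_of g u x t : (t <= T)%N -> u_of (submxcol (z_of g u x)) t = u t.
Proof.
move=> tT; rewrite -[RHS]submxcolK; apply/eq_mxcol => i.
by rewrite mxcolK /z_u col_mxKd col_mxKu sample_tstack.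
Qed.

Lemma x_of_z_of g u x t : (t <= T)%N -> x_of (submxcol (z_of g u x)) t = x t.
Proof.
move=> tT; rewrite -[RHS]submxcolK; apply/eq_mxcol => i.
by rewrite mxcolK /z_x !col_mxKd sample_tstack.
Qed.

Lemma u_ofB (z z' : 'cV[R]_(ztot G Td T Tini)) t :
  u_of (submxcol (z - z')) t = u_of (submxcol z) t - u_of (submxcol z') t.
Proof.
rewrite /u_of -mxcolB; apply/eq_mxcol => i.
by rewrite /z_u /sample; apply/colP => k; rewrite !mxE.
Qed.

Lemma Acal_z_of g u x : P_feasible ud xd uini xini g u x ->
  Acal Td T Tini ud xd *m z_of g u x = \mxcol_i node_b T Tini uini xini i.
Proof.
move=> feas; apply/AcalE.
have -> : (fun i => z_g (submxcol (z_of g u x) i)) = g.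
  by apply/funext => i; rewrite mxcolK /z_g col_mxKu.
by apply: eq_P_feasible feas => t tT; rewrite u_of_z_of // x_of_z_of.
Qed.

(** * Costs and the inputs of saddle points *)

Context (Q_psd : forall i, psd (Q i)) (W_pd : forall i, pd (W i)).

Lemma psd_node_Q i : psd (node_Q Td T Tini Q W i).
Proof.
apply: psd_block_diag; first exact: psd0.
apply: psd_block_diag; apply: psd_mxdiag => t; case: ifP => _; do ?exact: psd0.
  exact: pd_psd.
exact: Q_psd.
Qed.

Lemma psd_Qcal : psd (Qcal Td T Tini Q W).
Proof. exact: psd_mxdiag psd_node_Q. Qed.

Lemma Qcal_lqr_cost (z : 'cV[R]_(ztot G Td T Tini)) :
  (z^T *m Qcal Td T Tini Q W *m z) 0 0
    = lqr_cost Q W T (u_of (submxcol z)) (x_of (submxcol z)).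
Proof.
rewrite quad_mxdiag.
transitivity (\sum_i node_cost Q W T i (u_of (submxcol z)) (x_of (submxcol z))).
  apply: eq_bigr => i _; rewrite -wnorm_sqr; last exact: psd_node_Q.
  apply: node_QE => // [|t _]; first exact: pd_psd.
  by rewrite /ui /xi !mxcolK.
rewrite exchange_big; apply: eq_bigr => t _ /=.
rewrite big_split /= !wnorm_sqr ?quad_mxdiag; last 2 first.
- by apply: psd_mxdiag => i; exact: pd_psd.
- exact: psd_mxdiag.
by congr (_ + _); apply: eq_bigr => i _; rewrite wnorm_sqr //; exact: pd_psd.
Qed.

Lemma lqr_cost_ge0 u x : 0 <= lqr_cost Q W T u x.
Proof. by apply: sumr_ge0 => t _; rewrite addr_ge0 ?sqr_ge0. Qed.

(** Only inputs are determined by a zero cost: their weights are definite, those of the states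
    semidefinite. *)
Lemma lqr_cost0_input u x : lqr_cost Q W T u x = 0 ->
  forall t, (t < T)%N -> u t = 0.
Proof.
move=> /eqP; rewrite psumr_eq0 => [/allP c0 t tT|t _]; last by rewrite addr_ge0 ?sqr_ge0.
have := c0 (Ordinal tT) (mem_index_enum _).
rewrite paddr_eq0 ?sqr_ge0 //= => /andP[_].
have Wpd := pd_mxdiag W_pd; rewrite wnorm_sqr; last exact: pd_psd.
by apply: contraTeq => /Wpd.2 /lt0r_neq0.
Qed.

(** The optimum of (L) lifts to a feasible point [zs] of (P). For [d := zs - z], stationarity makes
    the cost of [zs] the sum of those of [d] and [z], while optimality bounds it by that of [z]. So
    [d] has zero cost, hence zero inputs. *)
Lemma saddle_point_input z lam ustar xstar : (0 < Tini)%N ->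
  controllable G -> trajectory Td ud xd ->
  persistently_exciting Td ud (nx G + tau T Tini)%N \/
  (forall i : 'I_N, i \in act G ->
     persistently_exciting Td (node_input i ud xd) (xdim i + tau T Tini)%N) /\
  (forall i : 'I_N, i \notin act G ->
     persistently_exciting Td (xN i xd) (xdim i + tau T Tini)%N) ->
  trajectory Tini uini xini ->
  lqr_optimal Q W T Tini uini xini ustar xstar ->
  KKTmx Td T Tini ud xd Q W *m col_mx z lam
    = col_mx 0 (\mxcol_i node_b T Tini uini xini i) ->
  forall t, (t < T)%N -> u_of (submxcol z) t = ustar t.
Proof.
move=> Tini_gt0 ctrl data PE ini [star_feas star_min].
rewrite /KKTmx mul_block_col mul0mx addr0 => /eq_col_mx[stat feas] t tT.
have [gs Hgs] := trajectory_Hmx data ctrl PE (lqr_feasible_trajectory ini star_feas).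
have Pstar : P_feasible ud xd uini xini gs ustar xstar.
  by move=> i; split=> //; case: star_feas => _ _; rewrite /xi => ->; rewrite submxcol0.
pose zs := z_of gs ustar xstar; have feass := Acal_z_of Pstar.
have Pz := (AcalE _ _ _ _ _).1 feas.
have := star_min _ _ (P_feasible_lqr_feasible Tini_gt0 data Pz).
have <- : lqr_cost Q W T (u_of (submxcol zs)) (x_of (submxcol zs))
    = lqr_cost Q W T ustar xstar.
  by apply: eq_bigr => s _; rewrite u_of_z_of ?x_of_z_of // ltnW.
rewrite -!Qcal_lqr_cost; set q := Qcal _ _ _ _ _ in stat *.
have qT : q^T = q by have [] := psd_Qcal.
have [d dE] : exists d, d = zs - z by exists (zs - z).
have -> : zs = d + z by rewrite dE subrK.
have Ad : Acal Td T Tini ud xd *m d = 0 by rewrite dE mulmxBr feass feas subrr.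
(* Stationarity is tested against [d]; the multiplier term drops out because [d] is in the kernel of
   the constraints. *)
have dqz : d^T *m q *m z = 0.
  have := congr1 (mulmx d^T) stat; rewrite qT mulmx0 mulmxDr !mulNmx !mulmxN.
  rewrite (mulmxA _ (Acal _ _ _ _ _)^T) -trmx_mul Ad trmx0 mul0mx oppr0 addr0.
  by rewrite -scalemxAl -scalemxAr mulmxA => /eqP; rewrite oppr_eq0 scaler_eq0 pnatr_eq0 => /eqP.
have zqd : z^T *m q *m d = 0.
  by apply: trmx_inj; rewrite !trmx_mul trmxK qT trmx0 mulmxA.
have -> : (d + z)^T *m q *m (d + z) = d^T *m q *m d + z^T *m q *m z.
  have -> : (d + z)^T = d^T + z^T by rewrite linearD.
  by rewrite !mulmxDl !mulmxDr dqz zqd addr0 add0r.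
rewrite [X in X <= _]mxE gerDr Qcal_lqr_cost => dle.
have d0 := le_anti (introT andP (conj dle (lqr_cost_ge0 _ _))).
have := lqr_cost0_input d0 tT; rewrite dE u_ofB u_of_z_of ?(ltnW tT) // => /eqP.
by rewrite subr_eq0 => /eqP.
Qed.

(** * The flow as an affine vector field *)

Lemma lagrangianE z (lam : 'cV[R]_(ctot G T Tini)) :
  lagrangian ud xd Q W uini xini z lam =
    (z^T *m Qcal Td T Tini Q W *m z) 0 0
    + (lam^T *m (Acal Td T Tini ud xd *m z - \mxcol_i node_b T Tini uini xini i)) 0 0.
Proof.
rewrite /lagrangian big_split quad_mxdiag; congr (_ + _).
  by apply: eq_bigr => i _; rewrite wnorm_sqr //; exact: psd_node_Q.
rewrite -[lam in RHS]submxcolK tr_mxcol /Acal mxcol_mul -mxcolB mul_mxrow_mxcol summxE.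
by apply: eq_bigr => i _; rewrite -mulmxA FmxE.
Qed.

Lemma grad_lagrangian_z z (lam : 'cV[R]_(ctot G T Tini)) :
  grad (fun z' => lagrangian ud xd Q W uini xini z' lam) z
    = 2%:R *: (Qcal Td T Tini Q W *m z) + (Acal Td T Tini ud xd)^T *m lam.
Proof.
have [qT _] := psd_Qcal.
rewrite -(grad_quadratic _ (\mxcol_i node_b T Tini uini xini i) _ _ qT).
by congr (grad _ z); apply/funext => v; exact: lagrangianE.
Qed.

Lemma grad_lagrangian_lam z (lam : 'cV[R]_(ctot G T Tini)) :
  grad (fun lam' => lagrangian ud xd Q W uini xini z lam') lam
    = Acal Td T Tini ud xd *m z - \mxcol_i node_b T Tini uini xini i.
Proof.
rewrite -[RHS](grad_affine ((z^T *m Qcal Td T Tini Q W *m z) 0 0) _ lam).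
by congr (grad _ lam); apply/funext => v; exact: lagrangianE.
Qed.

Lemma flowE z (lam : 'cV[R]_(ctot G T Tini)) :
  col_mx (\mxcol_i zdot ud xd Q W uini xini z lam i)
         (\mxcol_i lamdot ud xd Q W uini xini z lam i)
  = KKTmx Td T Tini ud xd Q W *m col_mx z lam
    - col_mx 0 (\mxcol_i node_b T Tini uini xini i).
Proof.
have [qT _] := psd_Qcal.
rewrite /zdot /lamdot grad_lagrangian_z grad_lagrangian_lam mxcolN !submxcolK.
rewrite /KKTmx mul_block_col mul0mx addr0 opp_col_mx add_col_mx oppr0 addr0 qT.
by rewrite !mulNmx -opprD -scalemxAl.
Qed.

Lemma norm_u_of (z : 'cV[R]_(ztot G Td T Tini)) :
  \sum_(t < T) norm2 (u_of (submxcol z) t) ^+ 2 <= norm2 z ^+ 2.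
Proof.
rewrite sqr_norm2_blocks; under eq_bigr do rewrite sqr_norm2_blocks.
rewrite exchange_big; apply: ler_sum => i _ /=.
rewrite -[submxcol z i]vsubmxK sqr_norm2_col_mx -[dsubmx _]vsubmxK sqr_norm2_col_mx.
rewrite (le_trans _ (_ : norm2 (usubmx (dsubmx (submxcol z i))) ^+ 2 <= _)) //; last first.
  by rewrite addrCA lerDl addr_ge0 ?sqr_ge0.
(* Inputs are compared on [T] samples while [z] stores [T + 1]; the last one is dropped. *)
rewrite sqr_norm2_blocks big_ord_recr /= ler_wpDr ?sqr_ge0 //.
apply: ler_sum => t _; rewrite mxcolK /z_u /sample.
by have -> : inord t = widen_ord (leqnSn T) t by apply/val_inj; rewrite /= inordK // ltnS ltnW.
Qed.
End DataProblem.

Theorem propositionV3 (R : realType) (G : network R)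
    (Q : forall i : 'I_(nnode G), 'M[R]_(xdim i))
    (W : forall i : 'I_(nnode G), 'M[R]_(udim i))
    (Td T Tini : nat)
    (ud : nat -> 'cV[R]_(nu G)) (xd : nat -> 'cV[R]_(nx G))
    (uini : nat -> 'cV[R]_(nu G)) (xini : nat -> 'cV[R]_(nx G))
    (ustar : nat -> 'cV[R]_(nu G)) (xstar : nat -> 'cV[R]_(nx G))
    (delta : R)
    (z : 'cV[R]_(ztot G Td T Tini)) (lam : 'cV[R]_(ctot G T Tini))
    (Tini_gt0 : (0 < Tini)%N)
    (Q_psd : forall i : 'I_(nnode G), psd (Q i))
    (W_pd : forall i : 'I_(nnode G), i \in act G -> pd (W i))
    (AB_controllable : controllable G)
    (data_trajectory : trajectory Td ud xd)
    (data_exciting :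
      persistently_exciting Td ud (nx G + tau T Tini)%N \/
      (forall i : 'I_(nnode G), i \in act G ->
         persistently_exciting Td (fun t => col_mx (ui i ud t) (xN i xd t))
           (xdim i + tau T Tini)%N) /\
      (forall i : 'I_(nnode G), i \notin act G ->
         persistently_exciting Td (xN i xd) (xdim i + tau T Tini)%N))
    (P_always_feasible :
      forall (u0 : nat -> 'cV[R]_(nu G)) (x0 : nat -> 'cV[R]_(nx G)),
        trajectory Tini u0 x0 ->
        exists (g : 'I_(nnode G) -> 'cV[R]_(gdim Td T Tini))
               (u : nat -> 'cV[R]_(nu G)) (x : nat -> 'cV[R]_(nx G)),
          P_feasible ud xd u0 x0 g u x)
    (ini_trajectory : trajectory Tini uini xini)
    (star_optimal : lqr_optimal Q W T Tini uini xini ustar xstar)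
    (delta_gt0 : 0 < delta) :
  let M := KKTmx Td T Tini ud xd Q W in
  let rho := delta ^+ 2 / ((nnode G)%:R * opnorm2 (mp_pinv M) ^+ 2) in
  (forall i : 'I_(nnode G),
     norm2 (col_mx (zdot ud xd Q W uini xini z lam i)
                   (lamdot ud xd Q W uini xini z lam i)) ^+ 2 < rho) ->
  signal_norm T (fun t => u_of (submxcol z) t - ustar t) < delta.
Proof.
move=> M rho small.
(* Outside [act G] the weight is an empty matrix, positive definite because there is no nonzero
   vector. *)
have Wpd i : pd (W i).
  have [/W_pd //|iS] := boolP (i \in act G).
  have col0 (m : nat) (A : 'M[R]_(udim i, m)) : A = 0.
    by apply/matrixP => k; have := ltn_ord k; rewrite [X in (_ < X)%N]udim_nact.
  by split=> [|x]; [rewrite [W i]col0 trmx0 | rewrite [x]col0 eqxx].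
(* A feasible point of (P) puts the right-hand side in the range of the constraint matrix. *)
have [g [u0 [x0 /Acal_z_of feas]]] := P_always_feasible _ _ ini_trajectory.
have [ys] := saddle_point_exists (Acal Td T Tini ud xd) (z_of g u0 x0)
  (psd_Qcal Td T Tini Q_psd Wpd).
rewrite feas -/(KKTmx Td T Tini ud xd Q W) -/M => ysE.
(* [w] is [y - ys] without its component in the kernel of [M], so the velocity [M *m (y - ys)]
   controls its length. *)
pose y := col_mx z lam; pose w := mp_pinv M *m (M *m (y - ys)).
have [pM _ _ _] := mp_pinvP M.
have yw : M *m (y - w) = col_mx 0 (\mxcol_i node_b T Tini uini xini i).
  by rewrite mulmxBr /w !mulmxA pM mulmxBr opprB addrCA subrr addr0.
have uE t : (t < T)%N ->
    u_of (submxcol z) t - ustar t = u_of (submxcol (usubmx w)) t.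
  have {}yw : M *m col_mx (z - usubmx w) (lam - dsubmx w)
      = col_mx 0 (\mxcol_i node_b T Tini uini xini i).
    by rewrite -yw -add_col_mx -opp_col_mx vsubmxK.
  move=> tT; rewrite -(saddle_point_input Q_psd Wpd Tini_gt0 AB_controllable
    data_trajectory data_exciting ini_trajectory star_optimal yw tT).
  by rewrite -u_ofB subKr.
have -> : signal_norm T (fun t => u_of (submxcol z) t - ustar t)
    = Num.sqrt (\sum_(t < T) norm2 (u_of (submxcol (usubmx w)) t) ^+ 2).
  by congr Num.sqrt; apply: eq_bigr => t _; rewrite uE.
rewrite -[delta]ger0_norm ?ltW // -sqrtr_sqr ltr_sqrt ?exprn_gt0 //.
apply: le_lt_trans (norm_u_of _) _.
apply: (@le_lt_trans _ _ (norm2 w ^+ 2)).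
  by rewrite -[w in leRHS]vsubmxK sqr_norm2_col_mx lerDl sqr_ge0.
pose kappa := opnorm2 (mp_pinv M).
apply: (@le_lt_trans _ _ (kappa ^+ 2 * norm2 (M *m (y - ys)) ^+ 2)).
  rewrite -exprMn lerXn2r ?nnegrE ?norm2_ge0 ?(le_trans (norm2_ge0 w)) //;
  exact: norm2_mulmx.
(* The squared norm of the velocity is regrouped from its primal and dual stacks into contributions
   of the nodes. *)
rewrite mulmxBr ysE -flowE // sqr_norm2_col_mx !sqr_norm2_blocks -big_split /=.
under eq_bigr do rewrite !mxcolK -sqr_norm2_col_mx.
(* The denominator of [rho] vanishes without nodes or for [kappa = 0]; in both cases the quantity to
   bound is 0, below [delta ^+ 2]. *)
have [N0|N_gt0] := posnP (nnode G).
  rewrite big1 ?mulr0 ?exprn_gt0 // => i _.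
  by have := ltn_ord i; rewrite [X in (_ < X)%N]N0.
have [->|k0] := eqVneq kappa 0; first by rewrite expr0n mul0r exprn_gt0.
have k2 : 0 < kappa ^+ 2 by rewrite exprn_even_gt0.
have N0 : 0 < (nnode G)%:R :> R by rewrite ltr0n.
have -> : delta ^+ 2 = kappa ^+ 2 * \sum_(i < nnode G) rho.
  rewrite sumr_const card_ord -mulr_natr /rho -/kappa.
  by field; rewrite k0 gt_eqF.
rewrite ltr_pM2l // ltr_sum //.
by apply/hasP; exists (Ordinal N_gt0); rewrite ?mem_index_enum.
Qed.
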